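(* Let $\mathfrak{g}$ be a topological Lie algebra, and let $V$ be a topological right $\mathfrak{g}$-module and topological left $\mathfrak{g}$-comodule. Then $V$ is a topological right-left AYD (anti-Yetter–Drinfeld) module over $\mathfrak{g}$ if and only if it is a topological right-left AYD module over the topological Hopf algebra $U(\mathfrak{g})$, where $V$ is regarded as a right $U(\mathfrak{g})$-module by extending the $\mathfrak{g}$-action, and as a left $U(\mathfrak{g})$-comodule through the correspondence between $\mathfrak{g}$-coactions and $U(\mathfrak{g})$-coactions given by $\nabla_{\mathfrak g}\leftrightarrow\nabla_{\mathfrak g}^{\exp}$ described in the context.
   Context: All topological vector spaces (t.v.s.) are well-behaved (nuclear Fréchet, or the strong dual of a nuclear Fréchet space); $\widehat{\otimes}_\pi$ is the completed projective tensor product; $k$ is a field of characteristic zero; $\mathfrak{g}$ is of countable dimension, and $\mathfrak{g}$, $U(\mathfrak{g})$ carry the natural topology (strict inductive limit of finite-dimensional subspaces). A topological left $\mathfrak{g}$-comodule is a t.v.s. $V$ with a continuous linear map $\nabla_{\mathfrak g}:V\to\mathfrak{g}\,\widehat\otimes_\pi V$, $\nabla_{\mathfrak g}(v)=v_{[-1]}\otimes v_{[0]}$, such that $v_{[-2]}\wedge v_{[-1]}\otimes v_{[0]}=0$, where $v_{[-2]}\otimes v_{[-1]}\otimes v_{[0]}=(\mathrm{Id}\otimes\nabla_{\mathfrak g})\nabla_{\mathfrak g}(v)$, and similarly for higher iterates. $V$ is a topological right-left AYD module over $\mathfrak{g}$ if for all $v\in V$, $X\in\mathfrak{g}$, $$\nabla_{\mathfrak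 g}(v\cdot X)=v_{[-1]}\otimes v_{[0]}\cdot X+[v_{[-1]},X]\otimes v_{[0]}.$$ For a topological Hopf algebra $\mathcal{H}$, a topological right $\mathcal{H}$-module and left $\mathcal{H}$-comodule $V$ (coaction $v\mapsto v_{<-1>}\otimes v_{<0>}\in\mathcal{H}\widehat\otimes_\pi V$) is a right-left AYD module over $\mathcal{H}$ if for all $v\in V$, $h\in\mathcal{H}$, the coaction of $v\cdot h$ equals $S(h_{(3)})v_{<-1>}h_{(1)}\otimes v_{<0>}\cdot h_{(2)}$. Correspondence of coactions: a left $U(\mathfrak{g})$-coaction induces a left $\mathfrak{g}$-coaction by composing with $\pi\otimes\mathrm{Id}$, where $\pi:U(\mathfrak{g})\to\mathfrak{g}$ is the canonical projection; conversely a left $\mathfrak{g}$-coaction yields the left $U(\mathfrak{g})$-coaction $$\nabla_{\mathfrak g}^{\exp}(v)=\sum_{k=0}^\infty\frac1{k!}\,v_{[-k]}\cdots v_{[-1]}\otimes v_{[0]}\in U(\mathfrak{g})\,\widehat\otimes_\pi V.$$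
   Formalization: The series for the exponential coaction need not converge (g = kX, V = k, coaction v ↦ X⊗v), so it is assumed to converge to a topological U(g)-coaction that induces the given g-coaction; topological modules are taken with separately continuous action. *)

(* Defs.v *)
From HB Require Import structures.
From mathcomp Require Import all_boot all_order all_algebra perm.
From mathcomp Require Import all_classical all_reals all_analysis.

Set Implicit Arguments.
Unset Strict Implicit.
Unset Printing Implicit Defensive.

Import Order.TTheory GRing.Theory Num.Theory numFieldNormedType.Exports.
Local Open Scope classical_set_scope.
Local Open Scope ring_scope.

(* The ground field is a [numFieldType] K, with the topology of its absolute
   value; the real and the complex numbers are instances. Topological vector
   spaces are locally convex: they are the [tvsType K] of the library. *)

(* ** Continuous linear and bilinear maps *)

Definition clinear (K : numFieldType) (E F : tvsType K) (f : E -> F) : Prop :=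
  linear f /\ continuous f.

Definition bilinear_map (K : numFieldType) (E F G : lmodType K)
    (f : E -> F -> G) : Prop :=
  (forall x, linear (f x)) /\ (forall y, linear (fun x => f x y)).

Definition cbilinear (K : numFieldType) (E F G : tvsType K)
    (f : E -> F -> G) : Prop :=
  bilinear_map f /\ continuous (fun p : E * F => f p.1 p.2).

(* ** Well-behaved spaces *)

(* [tvsType] does not force its entourages to be the translation invariant ones,
   so Cauchy filters are defined from the differences x - y and not through the
   library's [cauchy]. *)
Definition tvs_complete (K : numFieldType) (E : tvsType K) : Prop :=
  forall F : set_system E, ProperFilter F ->
    (fun p : E * E => p.1 - p.2) @ (F, F) --> (0 : E) ->
    exists x : E, F --> x.

Definition frechet (K : numFieldType) (E : tvsType K) : Prop :=
  [/\ hausdorff_space E, tvs_complete E &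
      exists U : nat -> set E, (forall n, nbhs 0 (U n)) /\
        (forall W : set E, nbhs 0 W -> exists n, U n `<=` W)].

Definition seminorm (K : numFieldType) (E : lmodType K) (p : E -> K) : Prop :=
  [/\ forall x, 0 <= p x, forall x y, p (x + y) <= p x + p y &
      forall a x, p (a *: x) = `|a| * p x].

(* f(x) = sum_n lam_n a_n(x) y_n, with lam summable, (a_n) equicontinuous and
   (y_n) bounded *)
Definition nuclear_map (K : numFieldType) (E : tvsType K)
    (B : completeNormedModType K) (f : E -> B) : Prop :=
  exists (lam : nat -> K^o) (a : nat -> E -> K^o) (y : nat -> B),
    [/\ cvgn (series (fun n => `|lam n| : K^o)),
        (forall n, linear (a n)) /\
          (\forall x \near (0 : E), forall n, `|a n x| <= 1),
        forall n, `|y n| <= 1 &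
        forall x, series (fun n => (lam n * a n x) *: y n) @ \oo --> f x].

(* For every continuous seminorm p, the canonical map from E to the Banach space
   completing E / p^-1(0) is nuclear. That completion is described as a Banach
   space B with a linear map j of dense range such that |j x| = p x. *)
Definition nuclear (K : numFieldType) (E : tvsType K) : Prop :=
  forall p : E -> K^o, seminorm p -> continuous p ->
  forall (B : completeNormedModType K) (j : E -> B),
    linear j -> (forall x, `|j x| = p x) -> dense (range j) ->
    nuclear_map j.

Definition tvs_bounded (K : numFieldType) (E : tvsType K) (A : set E) : Prop :=
  forall U : set E, nbhs 0 U ->
    exists r : K, forall x, A x -> exists2 u, U u & x = r *: u.

(* V is isomorphic to the space of continuous linear forms on E with the topology
   of uniform convergence on bounded sets; b v is the form attached to v. *)
Definition is_strong_dual (K : numFieldType) (E V : tvsType K) : Prop :=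
  exists b : V -> E -> K^o,
    [/\ bilinear_map b,
        forall v, continuous (b v),
        forall f : E -> K^o, clinear f -> exists! v, b v = f &
        forall W : set V, nbhs 0 W <->
          exists (A : set E) (eps : K), [/\ tvs_bounded A, 0 < eps &
            forall v, (forall x, A x -> `|b v x| <= eps) -> W v]].

Definition well_behaved (K : numFieldType) (V : tvsType K) : Prop :=
  (frechet V /\ nuclear V) \/
  (exists E : tvsType K, [/\ frechet E, nuclear E & is_strong_dual E V]).

(* E is the union of an increasing sequence of finite-dimensional subspaces
   E_n = span (e_0, ..., e_(n-1)), and has the locally convex inductive limit
   topology: a convex set is a neighbourhood of 0 in E if and only if its trace
   on each E_n is a neighbourhood of 0 for the usual topology of E_n. *)
Definition natural_topology (K : numFieldType) (E : tvsType K) : Prop :=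
  exists e : nat -> E,
    (forall x, exists (n : nat) (c : 'I_n -> K), x = \sum_(i < n) c i *: e i) /\
    (forall W : set E, convex_set W ->
       (nbhs 0 W <-> forall n : nat, exists2 eps : K, 0 < eps &
          forall c : 'I_n -> K, (forall i, `|c i| < eps) ->
            W (\sum_(i < n) c i *: e i))).

(* ** Completed projective tensor products *)

Definition abs_convex_hull (K : numFieldType) (E : lmodType K) (A : set E)
    : set E :=
  [set z | exists (n : nat) (c : 'I_n -> K) (a : 'I_n -> E),
     [/\ forall i, A (a i), \sum_(i < n) `|c i| <= 1 &
         z = \sum_(i < n) c i *: a i]].

(* A choice, for all E and F, of a completed projective tensor product. It is
   determined up to unique isomorphism by the universal property [pt_univ];
   [pt_topology] records that the topology is the projective one. *)
Record projTensor (K : numFieldType) := ProjTensor {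
  ptens :> tvsType K -> tvsType K -> tvsType K;
  pure : forall E F : tvsType K, E -> F -> ptens E F;
  pt_hausdorff : forall E F : tvsType K, hausdorff_space (ptens E F);
  pt_complete : forall E F : tvsType K, tvs_complete (ptens E F);
  pt_topology : forall (E F : tvsType K) (W : set (ptens E F)),
    nbhs 0 W <-> exists (A : set E) (B : set F), [/\ nbhs 0 A, nbhs 0 B &
      closure (abs_convex_hull [set pure x y | x in A & y in B]) `<=` W];
  pt_cbilinear : forall E F : tvsType K, cbilinear (@pure E F);
  pt_univ : forall (E F G : tvsType K) (f : E -> F -> G),
    hausdorff_space G -> tvs_complete G -> cbilinear f ->
    exists! h : ptens E F -> G, clinear h /\ forall x y, h (pure x y) = f x y
}.

Arguments pure {K} p {E F} x y.

(* The continuous linear map sending x (x) y to f x y, and a junk value if there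
   is none. *)
Definition tlift (K : numFieldType) (T : projTensor K) (E F G : tvsType K)
    (f : E -> F -> G) : T E F -> G :=
  xget (fun=> 0) [set h | clinear h /\ forall x y, h (pure T x y) = f x y].

Arguments tlift {K} T {E F G} f _.

Definition tmap (K : numFieldType) (T : projTensor K) (E F E' F' : tvsType K)
    (f : E -> E') (g : F -> F') : T E F -> T E' F' :=
  tlift T (fun x y => pure T (f x) (g y)).

Arguments tmap {K} T {E F E' F'} f g _.

Definition tassoc (K : numFieldType) (T : projTensor K) (E F G : tvsType K)
    : T (T E F) G -> T E (T F G) :=
  tlift T (fun t z => tlift T (fun x y => pure T x (pure T y z)) t).

Arguments tassoc {K} T {E F G} _.

(* ** Topological Lie algebras, their modules and comodules *)

Record topLieAlgebra (K : numFieldType) := TopLieAlgebra {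
  lie_tvs :> tvsType K;
  bracket : lie_tvs -> lie_tvs -> lie_tvs;
  bracket_cbilinear : cbilinear bracket;
  bracket_alternating : forall x, bracket x x = 0;
  bracket_jacobi : forall x y z,
    bracket x (bracket y z) + bracket y (bracket z x) +
    bracket z (bracket x y) = 0
}.

(* Only separate continuity of actions is required, of Lie algebras here and of
   Hopf algebras below. This includes the jointly continuous actions, that is the
   continuous maps from the completed projective tensor product, and unlike joint
   continuity it passes from the action of g to the action of U(g): on the Frechet
   space K^nat, the action of K[X] = U(K) through the shift is not jointly
   continuous for the natural topology of K[X]. *)
Definition lie_rmodule (K : numFieldType) (g : topLieAlgebra K) (V : tvsType K)
    (act : V -> g -> V) : Prop :=
  [/\ bilinear_map act,
      forall X, continuous (fun v => act v X),
      forall v, continuous (act v) &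
      forall v X Y,
        act v (bracket X Y) = act (act v X) Y - act (act v Y) X].

(* X (x) Y (x) v |-> X /\ Y (x) v, where the exterior square of g is realized in
   g (x) g by X /\ Y = X (x) Y - Y (x) X. *)
Definition wedge (K : numFieldType) (T : projTensor K) (g V : tvsType K)
    : T g (T g V) -> T g (T g V) :=
  tlift T (fun X t =>
    tlift T (fun Y v => pure T X (pure T Y v) - pure T Y (pure T X v)) t).

Arguments wedge {K} T {g V} _.

Definition lie_lcomodule (K : numFieldType) (T : projTensor K)
    (g : topLieAlgebra K) (V : tvsType K) (nabla : V -> T g V) : Prop :=
  clinear nabla /\ forall v, wedge T (tmap T id nabla (nabla v)) = 0.

Definition lie_AYD (K : numFieldType) (T : projTensor K)
    (g : topLieAlgebra K) (V : tvsType K)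
    (act : V -> g -> V) (nabla : V -> T g V) : Prop :=
  [/\ lie_rmodule act, lie_lcomodule nabla &
      forall v X, nabla (act v X) =
        tmap T id (fun w => act w X) (nabla v) +
        tmap T (fun Y => bracket Y X) id (nabla v)].

(* ** Topological Hopf algebras, their modules and comodules *)

#[short(type="topAlgType")]
HB.structure Definition TopAlgebra (K : numFieldType) :=
  {A of GRing.Algebra K A & Tvs K A}.

Definition tprod (K : numFieldType) (T : projTensor K) (A : topAlgType K)
    (s t : T A A) : T A A :=
  tlift T (fun a b => tlift T (fun c d => pure T (a * c) (b * d)) t) s.

Arguments tprod {K} T {A} s t.

Record topHopfAlgebra (K : numFieldType) (T : projTensor K) := TopHopfAlgebra {
  hopf_alg :> topAlgType K;
  mul : T hopf_alg hopf_alg -> hopf_alg;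
  comul : hopf_alg -> T hopf_alg hopf_alg;
  counit : hopf_alg -> K^o;
  antipode : hopf_alg -> hopf_alg;
  mul_clinear : clinear mul;
  mul_pure : forall a b, mul (pure T a b) = a * b;
  comul_clinear : clinear comul;
  comul_mul : forall a b, comul (a * b) = tprod T (comul a) (comul b);
  comul_one : comul 1 = pure T 1 1;
  comul_coassoc : forall a,
    tassoc T (tmap T comul id (comul a)) = tmap T id comul (comul a);
  counit_clinear : clinear counit;
  counit_mul : forall a b, counit (a * b) = counit a * counit b;
  counit_one : counit 1 = 1;
  comul_counitl : forall a, tmap T counit id (comul a) = pure T (1 : K^o) a;
  comul_counitr : forall a, tmap T id counit (comul a) = pure T a (1 : K^o);
  antipode_clinear : clinear antipode;
  antipodel : forall a, mul (tmap T antipode id (comul a)) = counit a *: 1;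
  antipoder : forall a, mul (tmap T id antipode (comul a)) = counit a *: 1
}.

Definition alg_rmodule (K : numFieldType) (H : algType K) (V : lmodType K)
    (act : V -> H -> V) : Prop :=
  [/\ bilinear_map act, forall v, act v 1 = v &
      forall v a b, act v (a * b) = act (act v a) b].

Definition hopf_rmodule (K : numFieldType) (T : projTensor K)
    (H : topHopfAlgebra T) (V : tvsType K) (act : V -> H -> V) : Prop :=
  [/\ alg_rmodule act, forall a, continuous (fun v => act v a) &
      forall v, continuous (act v)].

Definition hopf_lcomodule (K : numFieldType) (T : projTensor K)
    (H : topHopfAlgebra T) (V : tvsType K) (nabla : V -> T H V) : Prop :=
  [/\ clinear nabla,
      forall v, tassoc T (tmap T (@comul _ _ H) id (nabla v)) =
                tmap T id nabla (nabla v) &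
      forall v, tmap T (@counit _ _ H) id (nabla v) = pure T (1 : K^o) v].

(* S(h_(3)) v_<-1> h_(1) (x) v_<0> h_(2), with
   h_(1) (x) h_(2) (x) h_(3) = (id (x) comul) (comul h) *)
Definition hopf_AYD_rhs (K : numFieldType) (T : projTensor K)
    (H : topHopfAlgebra T) (V : tvsType K)
    (act : V -> H -> V) (nabla : V -> T H V) (v : V) (h : H) : T H V :=
  tlift T (fun h1 r =>
    tlift T (fun h2 h3 =>
      tlift T (fun u w => pure T (antipode h3 * u * h1) (act w h2)) (nabla v)) r)
    (tmap T id (@comul _ _ H) (comul h)).

Definition hopf_AYD (K : numFieldType) (T : projTensor K)
    (H : topHopfAlgebra T) (V : tvsType K)
    (act : V -> H -> V) (nabla : V -> T H V) : Prop :=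
  [/\ hopf_rmodule act, hopf_lcomodule nabla &
      forall v h, nabla (act v h) = hopf_AYD_rhs act nabla v h].

(* ** The topological Hopf algebra U(g) *)

Definition lie_to_alg (K : numFieldType) (g : topLieAlgebra K) (A : algType K)
    (f : g -> A) : Prop :=
  linear f /\ forall X Y, f (bracket X Y) = f X * f Y - f Y * f X.

Definition alg_morphism (K : numFieldType) (A B : algType K) (f : A -> B)
    : Prop :=
  [/\ linear f, f 1 = 1 & forall a b, f (a * b) = f a * f b].

(* H, with iota : g -> H, is the enveloping algebra of g with its natural
   topology and its usual Hopf structure: comul and counit are algebra morphisms
   by definition of a Hopf algebra, and the antipode is antimultiplicative, so
   that all three are determined by their values on g. *)
Definition is_enveloping (K : numFieldType) (T : projTensor K)
    (g : topLieAlgebra K) (H : topHopfAlgebra T) (iota : g -> H) : Prop :=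
  [/\ lie_to_alg iota,
      forall (A : algType K) (f : g -> A), lie_to_alg f ->
        exists! phi : H -> A, alg_morphism phi /\ forall X, phi (iota X) = f X,
      natural_topology H &
      [/\ forall X, comul (iota X) = pure T (iota X) 1 + pure T 1 (iota X),
          forall X, counit (iota X) = 0,
          forall X, antipode (iota X) = - iota X &
          forall a b : H, antipode (a * b) = antipode b * antipode a]].

(* The projection of U(g) onto g along the Poincare-Birkhoff-Witt symmetrization
   U(g) = (+)_n S^n(g): it is the identity on g and kills the symmetrized
   products of n elements of g for every n <> 1. *)
Definition canonical_projection (K : numFieldType) (g : topLieAlgebra K)
    (H : algType K) (iota : g -> H) (pi : H -> g) : Prop :=
  [/\ linear pi, forall X, pi (iota X) = X &
      forall (n : nat) (x : 'I_n -> g), n != 1 ->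
        pi (\sum_(s : {perm 'I_n}) \prod_(i < n) iota (x (s i))) = 0].

(* ** The correspondence between g-coactions and U(g)-coactions *)

Fixpoint tpower (K : numFieldType) (T : projTensor K) (g V : tvsType K)
    (k : nat) : tvsType K :=
  if k is k'.+1 then T g (tpower T g V k') else V.

(* v |-> v_[-k] (x) ... (x) v_[-1] (x) v_[0] *)
Fixpoint iter_coaction (K : numFieldType) (T : projTensor K) (g V : tvsType K)
    (nabla : V -> T g V) (k : nat) : V -> tpower T g V k :=
  if k is k'.+1 return V -> tpower T g V k
  then fun v => tmap T id (@iter_coaction K T g V nabla k') (nabla v)
  else id.

(* X_1 (x) ... (x) X_k (x) v |-> iota X_1 ... iota X_k (x) v *)
Fixpoint mul_legs (K : numFieldType) (T : projTensor K) (g V : tvsType K)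
    (H : topAlgType K) (iota : g -> H) (k : nat) : tpower T g V k -> T H V :=
  if k is k'.+1 return tpower T g V k -> T H V
  then tlift T (fun X t =>
         tmap T (fun u : H => iota X * u) id (@mul_legs K T g V H iota k' t))
  else fun v => pure T 1 v.

Arguments iter_coaction {K} T {g V} nabla k _.
Arguments mul_legs {K} T {g V H} iota k _.

(* k-th term of nabla^exp(v) *)
Definition exp_term (K : numFieldType) (T : projTensor K) (g V : tvsType K)
    (H : topAlgType K) (iota : g -> H) (nabla : V -> T g V) (v : V) (k : nat)
    : T H V :=
  (k`!%:R : K)^-1 *: mul_legs T iota k (iter_coaction T nabla k v).

(* nablaU is nabla^exp, and conversely nabla is induced by nablaU through the
   canonical projection pi. *)
Definition coaction_correspondence (K : numFieldType) (T : projTensor K)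
    (g V : tvsType K) (H : topAlgType K) (iota : g -> H) (pi : H -> g)
    (nabla : V -> T g V) (nablaU : V -> T H V) : Prop :=
  (forall v, series (exp_term iota nabla v) @ \oo --> nablaU v) /\
  (forall v, tmap T pi id (nablaU v) = nabla v).

(* Main.v *)
(* From g to U(g): the g-AYD condition says that the coaction intertwines the
   action of X on V with the operator id (x) X + [-, X] (x) id. Hence so do all
   iterated coactions, and, multiplying the legs and passing to the limit, so does
   nabla^exp; this is the U(g)-AYD condition for h = X, because
   X_(1) (x) X_(2) (x) X_(3) = X (x) 1 (x) 1 + 1 (x) X (x) 1 + 1 (x) 1 (x) X.
   The h satisfying the U(g)-AYD condition form a subalgebra, hence all of U(g).

   From U(g) to g: apply pi (x) id to the condition for h = X. The projection pi
   satisfies pi [u, X] = [pi u, X]: this is clear on symmetrized products, which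
   span U(g).

   All multilinear maps on U(g), of countable dimension with its finest locally
   convex topology, are jointly continuous; therefore the maps that define the
   right-hand side of the AYD condition do extend to completed tensor products,
   although the action of U(g) on V is only separately continuous. *)

Require Import Defs.
From HB Require Import structures.
From mathcomp Require Import all_boot all_order all_algebra perm.
From mathcomp Require Import all_classical all_reals all_analysis.

Set Implicit Arguments.
Unset Strict Implicit.
Unset Printing Implicit Defensive.

Import Order.TTheory GRing.Theory Num.Theory numFieldNormedType.Exports.
Local Open Scope classical_set_scope.
Local Open Scope ring_scope.

(** * Linear maps, absolutely convex sets and continuity *)

Section LinearMaps.
Context (K : numFieldType).

Lemma lin_map0 (E F : lmodType K) (f : E -> F) : linear f -> f 0 = 0.
Proof.
by move=> lf; have := lf (-1) 0 0; rewrite scaler0 addr0 scaleN1r addNr.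
Qed.

Lemma lin_mapD (E F : lmodType K) (f : E -> F) :
  linear f -> forall x y, f (x + y) = f x + f y.
Proof. by move=> lf x y; have := lf 1 x y; rewrite !scale1r. Qed.

Lemma lin_mapZ (E F : lmodType K) (f : E -> F) :
  linear f -> forall a x, f (a *: x) = a *: f x.
Proof. by move=> lf a x; have := lf a x 0; rewrite (lin_map0 lf) !addr0. Qed.

Lemma lin_mapN (E F : lmodType K) (f : E -> F) :
  linear f -> forall x, f (- x) = - f x.
Proof. by move=> lf x; rewrite -scaleN1r lin_mapZ// scaleN1r. Qed.

Lemma lin_mapB (E F : lmodType K) (f : E -> F) :
  linear f -> forall x y, f (x - y) = f x - f y.
Proof. by move=> lf x y; rewrite (lin_mapD lf) (lin_mapN lf). Qed.

Lemma lin_map_sum (E F : lmodType K) (f : E -> F) : linear f ->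
  forall (I : Type) (r : seq I) (P : pred I) (h : I -> E),
  f (\sum_(i <- r | P i) h i) = \sum_(i <- r | P i) f (h i).
Proof.
move=> lf I r P h; elim/big_rec2: _ => [|i y x _ <-]; first exact: lin_map0.
exact: lin_mapD.
Qed.

Lemma linear_comp (E F G : lmodType K) (f : F -> G) (h : E -> F) :
  linear f -> linear h -> linear (fun x => f (h x)).
Proof. by move=> lf lh a x y; rewrite lh lf. Qed.

Lemma linear_add (E F : lmodType K) (f h : E -> F) :
  linear f -> linear h -> linear (fun x => f x + h x).
Proof. by move=> lf lh a x y; rewrite lf lh scalerDr addrACA. Qed.

Lemma linear_scale (E F : lmodType K) (b : K) (f : E -> F) :
  linear f -> linear (fun x => b *: f x).
Proof. by move=> lf a x y; rewrite lf scalerDr !scalerA mulrC. Qed.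

End LinearMaps.

Section AbsolutelyConvexSets.
Context (K : numFieldType).

Definition absconvex (E : lmodType K) (W : set E) : Prop :=
  W 0 /\ forall (a b : K) x y, `|a| + `|b| <= 1 -> W x -> W y ->
    W (a *: x + b *: y).

Lemma absconvexZ (E : lmodType K) (W : set E) (a : K) x :
  absconvex W -> `|a| <= 1 -> W x -> W (a *: x).
Proof.
move=> [W0 cW] a1 Wx; rewrite -[_ *: x]addr0 -(scaler0 _ (0 : K)).
by apply: cW => //; rewrite normr0 addr0.
Qed.

(** Induction on [n]: the first [n] terms are divided by the total [l] of their absolute values and
    the two-point condition is applied with weights [l] and [c ord_max]. If [l] is 0, those terms
    vanish. *)
Lemma absconvex_sum (E : lmodType K) (W : set E) (n : nat)
    (c : 'I_n -> K) (a : 'I_n -> E) :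
  absconvex W -> (forall i, W (a i)) -> \sum_(i < n) `|c i| <= 1 ->
  W (\sum_(i < n) c i *: a i).
Proof.
move=> cW; elim: n c a => [|n IH] c a Wa c1; first by rewrite big_ord0; exact: cW.1.
rewrite big_ord_recr/=; set l := \sum_(i < n) `|c (widen_ord (leqnSn n) i)|.
have l_ge0 : 0 <= l by apply: sumr_ge0 => i _.
have c1' : `|l| + `|c ord_max| <= 1.
  by move: c1; rewrite (ger0_norm l_ge0) big_ord_recr.
have [l0|l_neq0] := eqVneq l 0.
  rewrite big1 ?add0r => [|i _].
    by apply: absconvexZ => //; move: c1'; rewrite l0 normr0 add0r.
  have /(psumr_eq0P (fun j _ => normr_ge0 _)) : l = 0 by [].
  by move=> /(_ i isT)/normr0_eq0 ->; rewrite scale0r.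
rewrite (_ : \sum_(i < n) _ = l *: \sum_(i < n)
  (l^-1 * c (widen_ord (leqnSn n) i)) *: a (widen_ord (leqnSn n) i)).
  apply: cW.2 => //; apply: IH => //.
  under eq_bigr do rewrite normrM.
  by rewrite -mulr_sumr -/l ger0_norm ?invr_ge0// mulVf.
rewrite scaler_sumr; apply: eq_bigr => i _.
by rewrite scalerA mulrA divff// mul1r.
Qed.

Lemma sub_hull (E : lmodType K) (A : set E) : A `<=` abs_convex_hull A.
Proof.
move=> x Ax; exists 1%N, (fun=> 1), (fun=> x); split=> //.
  by rewrite big_ord1 normr1.
by rewrite big_ord1 scale1r.
Qed.

Lemma hull_min (E : lmodType K) (A W : set E) :
  absconvex W -> A `<=` W -> abs_convex_hull A `<=` W.
Proof.
by move=> cW AW _ [n [c [a [Aa c1 ->]]]]; apply: absconvex_sum => // i; exact: AW.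
Qed.

Lemma absconvex_hull (E : lmodType K) (A : set E) :
  absconvex (abs_convex_hull A).
Proof.
split=> [|a b x y ab1].
  exists 0%N, (fun=> 0), (fun=> 0); split; first by case.
    by rewrite big_ord0.
  by rewrite big_ord0.
move=> [n [c [u [Au c1 ->]]]] [m [d [v [Av d1 ->]]]].
(* [s] concatenates two families, so that one combination of [n + m] points represents
   [a *: x + b *: y]. *)
pose s T (f : 'I_n -> T) (h : 'I_m -> T) i :=
  match fintype.split i with inl j => f j | inr j => h j end.
exists (n + m)%N, (s _ (fun i => a * c i) (fun i => b * d i)), (s _ u v).
have sl T f h i : s T f h (lshift m i) = f i.
  by rewrite /s (unsplitK (inl i)).
have sr T f h i : s T f h (rshift n i) = h i.
  by rewrite /s (unsplitK (inr i)).
split.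
- by move=> i; rewrite /s; case: fintype.split.
- rewrite big_split_ord/=.
  under eq_bigr do rewrite sl normrM.
  under [X in _ + X <= _]eq_bigr do rewrite sr normrM.
  rewrite -!mulr_sumr (le_trans _ ab1)// lerD// ler_piMr//.
- rewrite big_split_ord/= !scaler_sumr; congr (_ + _); apply: eq_bigr => i _.
    by rewrite !sl scalerA.
  by rewrite !sr scalerA.
Qed.

Lemma absconvex_preimage (E F : lmodType K) (f : E -> F) (W : set F) :
  linear f -> absconvex W -> absconvex (f @^-1` W).
Proof.
move=> lf [W0 cW]; split=> [|a b x y ab1 Wx Wy] /=; first by rewrite lin_map0.
by rewrite lf (lin_mapZ lf); exact: cW.
Qed.

Lemma scaler_continuous (E : tvsType K) (c : K) :
  continuous (fun z : E => c *: z).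
Proof.
move=> z; apply: (@continuous_comp E (K^o * E)%type E (fun z => (c, z))
  (fun p => p.1 *: p.2)); last exact: scale_continuous.
by apply: (@cvg_pair _ _ _ _ (nbhs (c : K^o))); [exact: cvg_cst|exact: cvg_id].
Qed.

Lemma continuousD2 (T : topologicalType) (E : tvsType K) (f h : T -> E) x :
  {for x, continuous f} -> {for x, continuous h} ->
  {for x, continuous (fun y => f y + h y)}.
Proof.
move=> cf ch; apply: (@continuous_comp T (E * E)%type E
  (fun p => (f p, h p)) (fun p => p.1 + p.2)); last exact: add_continuous.
exact: (@cvg_pair _ _ _ _ (nbhs (f x)) (nbhs (h x))).
Qed.

Lemma absconvex_closure (E : tvsType K) (W : set E) :
  absconvex W -> absconvex (closure W).
Proof.
move=> [W0 cW]; split=> [|a b x y ab1 Wx Wy]; first exact: subset_closure.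
move=> B nB.
have [[B1 B2] /= [nB1 nB2] B12] : nbhs ((x, y) : E * E)
    ((fun p : E * E => a *: p.1 + b *: p.2) @^-1` B).
  have : {for ((x, y) : E * E), continuous (fun p : E * E => a *: p.1 + b *: p.2)}.
    apply: (@continuousD2 _ E (fun p : E * E => a *: p.1) (fun p => b *: p.2)).
      apply: (@continuous_comp (E * E)%type E E fst); first exact: cvg_fst.
      exact: scaler_continuous.
    apply: (@continuous_comp (E * E)%type E E snd); first exact: cvg_snd.
    exact: scaler_continuous.
  exact.
have [u [Wu B1u]] := Wx _ nB1; have [v [Wv B2v]] := Wy _ nB2.
by exists (a *: u + b *: v); split; [exact: cW|exact: (B12 (u, v))].
Qed.

End AbsolutelyConvexSets.

(** * Continuity of linear and bilinear maps, tested at 0 *)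

Section TvsContinuity.
Context (K : numFieldType).

Lemma nbhs_shift (E : tvsType K) (x y : E) (W : set E) :
  nbhs (x + y) W -> nbhs y (fun z => W (x + z)).
Proof.
move=> nW; have : {for y, continuous (fun z : E => x + z)}.
  by apply: continuousD2; [exact: cvg_cst|exact: cvg_id].
exact.
Qed.

Lemma linear_continuous0 (E F : tvsType K) (f : E -> F) : linear f ->
  (forall W, nbhs 0 W -> nbhs 0 (f @^-1` W)) -> continuous f.
Proof.
move=> lf cf x W nW.
have nW0 : nbhs 0 (fun z => W (f x + z)) by apply: nbhs_shift; rewrite addr0.
have := cf _ nW0; rewrite -(addNr x) => /nbhs_shift; apply: filterS => z /=.
by rewrite (lin_mapD lf) (lin_mapN lf) addrA subrr add0r.
Qed.

Lemma nbhs0_absorb (E : tvsType K) (x : E) (W : set E) : nbhs 0 W ->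
  exists2 s : K, 0 < s & forall t : K, `|t| <= s -> W (t *: x).
Proof.
move=> nW; have := @scale_continuous K E (0, x) W.
rewrite /= scale0r => /(_ nW)[[A B] /= [[e /= e0 eA] nB] AB].
have {nB} Bx := nbhs_singleton nB.
(* Halving makes the closed ball of radius [e / 2] fit in the open ball of radius [e]. *)
exists (e / 2); first by rewrite divr_gt0.
move=> t te; apply: (AB (t, x)); split => //; apply: (eA t).
rewrite /= sub0r normrN (le_lt_trans te)//.
by rewrite ltr_pdivrMr// ltr_pMr// ltr1n.
Qed.

Lemma nbhs0Z (E : tvsType K) (c : K) (W : set E) :
  nbhs 0 W -> nbhs 0 (fun x => W (c *: x)).
Proof.
by move=> nW; apply: (@scaler_continuous K E c 0 W); rewrite /= scaler0.
Qed.

Lemma nbhs0D (E : tvsType K) (W : set E) : nbhs 0 W ->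
  exists2 A : set E, nbhs 0 A & forall x y, A x -> A y -> W (x + y).
Proof.
move=> nW; have := @add_continuous E (0, 0) W; rewrite /= addr0 => /(_ nW).
move=> [[A1 A2] /= [nA1 nA2] A12]; exists (A1 `&` A2); first exact: filterI.
by move=> x y [A1x _] [_ A2y]; exact: (A12 (x, y)).
Qed.

(** Expand [f x y - f x0 y0] as [f (x - x0) y0 + f x0 (y - y0) + f (x - x0) (y - y0)]. The bound at
    0 controls the last term directly, and the other two after [y0] or [x0] has been scaled into the
    given neighbourhood. *)
Lemma bilinear_continuous0 (E F G : tvsType K) (f : E -> F -> G) :
  bilinear_map f ->
  (forall W : set G, nbhs 0 W -> exists (A : set E) (B : set F),
    [/\ nbhs 0 A, nbhs 0 B & forall x y, A x -> B y -> W (f x y)]) ->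
  cbilinear f.
Proof.
move=> bf cf; split=> // -[x0 y0] W; rewrite -[f _ _]addr0/= => /nbhs_shift nW.
have [W1 nW1 W1W] := nbhs0D nW; have [W2 nW2 W2W1] := nbhs0D nW1.
have cx : nbhs x0 (fun x => W1 (f (x - x0) y0)).
  have [A [B [nA nB AB]]] := cf _ nW1.
  have [s s0 sB] := nbhs0_absorb y0 nB.
  have : nbhs 0 (fun x => A (s^-1 *: x)) by exact: nbhs0Z.
  rewrite -(addNr x0) => /nbhs_shift; apply: filterS => x Ax.
  have /AB/(_ (sB s _)) := Ax; rewrite gtr0_norm// => /(_ (lexx _)).
  rewrite (lin_mapZ (bf.1 _)) (lin_mapZ (bf.2 _)) scalerA divff ?gt_eqF//.
  by rewrite scale1r addrC.
have cy : nbhs y0 (fun y => W2 (f x0 (y - y0))).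
  have [A [B [nA nB AB]]] := cf _ nW2.
  have [s s0 sA] := nbhs0_absorb x0 nA.
  have : nbhs 0 (fun x => B (s^-1 *: x)) by exact: nbhs0Z.
  rewrite -(addNr y0) => /nbhs_shift; apply: filterS => y By.
  have := AB _ _ (sA s _) By; rewrite gtr0_norm// => /(_ (lexx _)).
  rewrite (lin_mapZ (bf.1 _)) (lin_mapZ (bf.2 _)) scalerA mulVf ?gt_eqF//.
  by rewrite scale1r addrC.
have [A [B [nA nB AB]]] := cf _ nW2.
move: nA nB; rewrite -(addNr x0) -(addNr y0) => /nbhs_shift nA /nbhs_shift nB.
exists ((fun x => W1 (f (x - x0) y0)) `&` (fun x => A (- x0 + x)),
        (fun y => W2 (f x0 (y - y0))) `&` (fun y => B (- y0 + y))).
  by split; exact: filterI.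
move=> [x y] /= [[Wx Ax] [Wy By]].
have := W1W _ _ Wx (W2W1 _ _ Wy (AB _ _ Ax By)).
rewrite (addrC _ x) (addrC _ y) -(lin_mapD (bf.2 _)) (addrC x0) subrK addrA.
rewrite -(lin_mapD (bf.2 _)) (addrC x0) subrK -(lin_mapD (bf.1 _)).
by rewrite (addrC y0) subrK.
Qed.

Lemma clinear_comp (E F G : tvsType K) (f : F -> G) (h : E -> F) :
  clinear f -> clinear h -> clinear (fun x => f (h x)).
Proof.
move=> [lf cf] [lh ch]; split; first exact: linear_comp.
by move=> x; apply: continuous_comp; [exact: ch|exact: cf].
Qed.

Lemma clinear_add (E F : tvsType K) (f h : E -> F) :
  clinear f -> clinear h -> clinear (fun x => f x + h x).
Proof.
move=> [lf cf] [lh ch]; split; first exact: linear_add.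
by move=> x; apply: continuousD2; [exact: cf|exact: ch].
Qed.

Lemma clinear_scale (E F : tvsType K) (c : K) (f : E -> F) :
  clinear f -> clinear (fun x => c *: f x).
Proof.
move=> [lf cf]; split; first exact: linear_scale.
by move=> x; apply: continuous_comp; [exact: cf|exact: scaler_continuous].
Qed.

Lemma clinear_sub (E F : tvsType K) (f h : E -> F) :
  clinear f -> clinear h -> clinear (fun x => f x - h x).
Proof.
move=> cf ch; have := clinear_add cf (clinear_scale (-1) ch).
by under eq_fun do rewrite scaleN1r.
Qed.

Lemma clinear_id (E : tvsType K) : clinear (fun x : E => x).
Proof. by split=> // x; exact: cvg_id. Qed.

Lemma clinear0 (E F : tvsType K) : clinear (fun=> 0 : F) (E := E).
Proof.
by split=> [a x y|x]; [rewrite scaler0 addr0|exact: cvg_cst].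
Qed.

Lemma cbilinear_clinearl (E F G : tvsType K) (f : E -> F -> G) y :
  cbilinear f -> clinear (fun x => f x y).
Proof.
move=> [bf cf]; split; first exact: bf.2.
move=> x W nW; have [[A B] /= [nA nB] AB] := cf (x, y) W nW.
by apply: filterS nA => z Az; apply: (AB (z, y)); split=> //; exact: nbhs_singleton.
Qed.

Lemma cbilinear_clinearr (E F G : tvsType K) (f : E -> F -> G) x :
  cbilinear f -> clinear (f x).
Proof.
move=> [bf cf]; split; first exact: bf.1.
move=> y W nW; have [[A B] /= [nA nB] AB] := cf (x, y) W nW.
by apply: filterS nB => z Bz; apply: (AB (x, z)); split=> //; exact: nbhs_singleton.
Qed.

Lemma cbilinear_comp (E F G E' F' G' : tvsType K) (f : E -> F -> G)
    (p : E' -> E) (q : F' -> F) (r : G -> G') :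
  cbilinear f -> clinear p -> clinear q -> clinear r ->
  cbilinear (fun x y => r (f (p x) (q y))).
Proof.
move=> [[b1 b2] cf] [lp cp] [lq cq] [lr cr].
split; first split.
- by move=> x; apply: linear_comp => //; apply: linear_comp => //; exact: b1.
- move=> y; apply: (linear_comp lr).
  by apply: (linear_comp (b2 (q y))).
move=> [x y]; apply: (@continuous_comp _ _ _ (fun z : E' * F' => f (p z.1) (q z.2))).
  apply: (@continuous_comp _ (E * F)%type _ (fun z : E' * F' => (p z.1, q z.2))
    (fun z => f z.1 z.2)); last exact: cf.
  apply: (@cvg_pair _ _ _ _ (nbhs (p x)) (nbhs (q y))).
    by apply: continuous_comp; [exact: cvg_fst|exact: cp].
  by apply: continuous_comp; [exact: cvg_snd|exact: cq].
exact: cr.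
Qed.

Lemma cbilinear_nbhs0 (E F G : tvsType K) (f : E -> F -> G) (W : set G) :
  cbilinear f -> nbhs 0 W -> exists (A : set E) (B : set F),
    [/\ nbhs 0 A, nbhs 0 B & forall x y, A x -> B y -> W (f x y)].
Proof.
move=> [bf cf] nW; have := cf (0, 0) W.
rewrite /= (lin_map0 (bf.1 0)) => /(_ nW)[[A B]/= [nA nB] AB].
by exists A, B; split=> // x y Ax By; exact: (AB (x, y)).
Qed.

End TvsContinuity.
(** * The natural topology and completed tensor products *)

Section NaturalTopology.
Context (K : numFieldType).

Lemma nbhs0_finite_sum (E : tvsType K) (n : nat) (y : 'I_n -> E) (W : set E) :
  nbhs 0 W -> exists2 eps : K, 0 < eps &
    forall c : 'I_n -> K, (forall i, `|c i| < eps) -> W (\sum_(i < n) c i *: y i).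
Proof.
elim: n y W => [|n IH] y W nW.
  by exists 1 => // c _; rewrite big_ord0; exact: nbhs_singleton.
have [A nA AW] := nbhs0D nW.
have [e e0 eA] := IH (fun i => y (widen_ord (leqnSn n) i)) A nA.
have [s s0 sA] := nbhs0_absorb (y ord_max) nA.
have es0 : 0 < e + s by rewrite addr_gt0.
(* This positive number is at most [e] and at most [s], and no case distinction between them is
   made. *)
exists (e * s / (e + s)) => [|c ce]; first by rewrite divr_gt0// mulr_gt0.
rewrite big_ord_recr/=; apply: AW.
  apply: eA => i; apply: lt_le_trans (ce _) _.
  by rewrite ler_pdivrMr// ler_pM2l// lerDr ltW.
apply: sA; apply: ltW; apply: lt_le_trans (ce _) _.
by rewrite ler_pdivrMr// mulrC ler_pM2l// lerDl ltW.
Qed.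

(** The preimage of a convex neighbourhood is convex, so it only has to be tested on
    finite-dimensional subspaces, where [nbhs0_finite_sum] applies. *)
Lemma natural_linear_continuous (E F : tvsType K) (f : E -> F) :
  natural_topology E -> linear f -> continuous f.
Proof.
move=> [e [_ natE]] lf; apply: linear_continuous0 => // W nW.
have [B cB [oB basB]] := @tvs.locally_convex K F.
have [W' /= [BW' W'0] W'W] := basB 0 W nW.
suff : nbhs 0 (f @^-1` W') by apply: filterS => x; exact: W'W.
apply: (natE _ _).2 => [x y l|n].
  rewrite !inE /= => W'x W'y; have := cB W' (mem_set BW') (f x) (f y) l.
  by rewrite !inE => /(_ W'x W'y); rewrite /conv/= (lin_mapD lf) !(lin_mapZ lf).
have nW' : nbhs 0 W' by apply: open_nbhs_nbhs; split => //; exact: oB.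
have [s s0 sW] := nbhs0_finite_sum (fun i : 'I_n => f (e i)) nW'.
exists s => // c cs /=; rewrite (lin_map_sum lf).
by under eq_bigr do rewrite (lin_mapZ lf); exact: sW.
Qed.

(** The weights [s] may decrease arbitrarily fast; this freedom is what later makes every
    multilinear map jointly continuous. *)
Lemma natural_hull_nbhs (E : tvsType K) : natural_topology E ->
  exists e : nat -> E, forall s : nat -> K, (forall n, 0 < s n) ->
    nbhs 0 (abs_convex_hull (range (fun n => s n *: e n))).
Proof.
move=> [e [_ natE]]; exists e => s s0; set H := abs_convex_hull _.
have [H0 cH] := absconvex_hull (range (fun n => s n *: e n)).
apply: (natE _ _).2 => [x y l|n].
  rewrite !inE => Hx Hy; rewrite /conv/=; apply: cH => //.
  by rewrite /unstable.onem ger0_norm// ger0_norm ?subr_ge0// addrC subrK.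
pose d := \sum_(i < n) (s i)^-1.
have d_ge0 : 0 <= d by apply: sumr_ge0 => i _; rewrite invr_ge0 ltW.
have d1_gt0 : 0 < 1 + d by rewrite ltr_wpDr.
(* If [|c i| < (1 + d)^-1], the coefficients [c i / s i] have absolute values of sum at most
   [d / (1 + d)], hence at most 1. *)
exists (1 + d)^-1; first by rewrite invr_gt0.
move=> c cd; exists n, (fun i => c i / s i), (fun i => s i *: e i); split.
- by move=> i; exists (val i).
- apply: (@le_trans _ _ ((1 + d)^-1 * d)); last first.
    by rewrite mulrC ler_pdivrMr// mul1r lerDr.
  rewrite mulr_sumr; apply: ler_sum => i _.
  rewrite normrM normfV (gtr0_norm (s0 i)) ler_pM2r ?invr_gt0//.
  exact: ltW (cd i).
- by apply: eq_bigr => i _; rewrite scalerA divfK// gt_eqF.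
Qed.

(* If [s i j k *: f (e1 i) (e2 j) (e3 k)] lies in [W] with [s i j k <= 1], let
   [r n] be the product of the [s i j k] over [i, j, k <= n]; then
   [r i * r j * r k <= s i j k]. *)
Lemma trilinear_weights (E1 E2 E3 : lmodType K) (G : tvsType K)
    (e1 : nat -> E1) (e2 : nat -> E2) (e3 : nat -> E3)
    (f : E1 -> E2 -> E3 -> G) (W : set G) :
  (forall y z, linear (fun x => f x y z)) ->
  (forall x z, linear (fun y => f x y z)) ->
  (forall x y, linear (f x y)) ->
  nbhs 0 W -> absconvex W ->
  exists2 r : nat -> K, (forall n, 0 < r n) &
    forall x y z, abs_convex_hull (range (fun n => r n *: e1 n)) x ->
      abs_convex_hull (range (fun n => r n *: e2 n)) y ->
      abs_convex_hull (range (fun n => r n *: e3 n)) z -> W (f x y z).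
Proof.
move=> l1 l2 l3 nW cW.
have /choice[s0 s0P] (p : nat * nat * nat) : exists t : K, [/\ 0 < t, t <= 1 &
    W (t *: f (e1 p.1.1) (e2 p.1.2) (e3 p.2))].
  have [t t0 tW] := nbhs0_absorb (f (e1 p.1.1) (e2 p.1.2) (e3 p.2)) nW.
  have t1 : 0 < 1 + t by rewrite addr_gt0.
  exists (t / (1 + t)); split; first by rewrite divr_gt0.
    by rewrite ler_pdivrMr// mul1r lerDr.
  apply: tW; rewrite ger0_norm ?divr_ge0 ?ltW// ltr_pdivrMr// ltr_pMr//.
  by rewrite ltrDl.
pose s i j k := s0 (i, j, k).
have sP i j k : [/\ 0 < s i j k, s i j k <= 1 &
    W (s i j k *: f (e1 i) (e2 j) (e3 k))] by exact: (s0P (i, j, k)).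
pose r n := \prod_(p : 'I_n.+1 * 'I_n.+1 * 'I_n.+1) s p.1.1 p.1.2 p.2.
have r_gt0 n : 0 < r n by apply: prodr_gt0 => p _; have [] := sP p.1.1 p.1.2 p.2.
have r_le1 n : r n <= 1.
  apply: prodr_ile1 => p _; have [s_gt0 s_le1 _] := sP p.1.1 p.1.2 p.2.
  by rewrite ltW.
have r_le m i j k : (i <= m)%N -> (j <= m)%N -> (k <= m)%N -> r m <= s i j k.
  move=> im jm km; rewrite /r (bigD1 (inord i, inord j, inord k))//= !inordK//.
  rewrite ler_piMr//; first by have [/ltW] := sP i j k.
  apply: prodr_ile1 => p _; have [s_gt0 s_le1 _] := sP p.1.1 p.1.2 p.2.
  by rewrite ltW.
exists r => // x y z Hx Hy Hz.
apply: (hull_min (absconvex_preimage (l1 y z) cW) _ Hx) => _ [i _ <-] /=.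
apply: (hull_min (absconvex_preimage (l2 _ z) cW) _ Hy) => _ [j _ <-] /=.
apply: (hull_min (absconvex_preimage (l3 _ _) cW) _ Hz) => _ [k _ <-] /=.
rewrite (lin_mapZ (l1 _ _)) (lin_mapZ (l2 _ _)) (lin_mapZ (l3 _ _)) !scalerA.
have [sijk0 _ Wf] := sP i j k.
have -> : r i * r j * r k *: f (e1 i) (e2 j) (e3 k) =
    (r i * r j * r k / s i j k) *: (s i j k *: f (e1 i) (e2 j) (e3 k)).
  by rewrite scalerA divfK// gt_eqF.
apply: absconvexZ => //.
rewrite ger0_norm; last by rewrite divr_ge0 ?mulr_ge0// ltW.
rewrite ler_pdivrMr// mul1r.
have r_ge0 n : 0 <= r n by exact: ltW.
(* Let [m] be the largest of [i], [j], [k]: then [r m <= s i j k], and the two other factors are at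
   most 1. *)
have [jk|kj] := leqP j k; last first.
  have {}kj := ltnW kj.
  have [ij|ji] := leqP i j.
    apply: le_trans (r_le j i j k ij (leqnn j) kj).
    by rewrite mulrAC ler_piMl// mulr_ile1.
  have {}ji := ltnW ji.
  apply: le_trans (r_le i i j k (leqnn i) ji (leq_trans kj ji)).
  by rewrite -mulrA ler_piMr// mulr_ile1.
have [ik|ki] := leqP i k.
  apply: le_trans (r_le k i j k ik jk (leqnn k)).
  by rewrite ler_piMl// mulr_ile1.
have {}ki := ltnW ki.
apply: le_trans (r_le i i j k (leqnn i) (leq_trans jk ki) ki).
by rewrite -mulrA ler_piMr// mulr_ile1.
Qed.

Lemma natural_trilinear (E1 E2 E3 G : tvsType K) (f : E1 -> E2 -> E3 -> G)
    (W : set G) :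
  natural_topology E1 -> natural_topology E2 -> natural_topology E3 ->
  (forall y z, linear (fun x => f x y z)) ->
  (forall x z, linear (fun y => f x y z)) ->
  (forall x y, linear (f x y)) ->
  nbhs 0 W -> absconvex W ->
  exists (A : set E1) (B : set E2) (C : set E3),
    [/\ nbhs 0 A, nbhs 0 B, nbhs 0 C &
        forall x y z, A x -> B y -> C z -> W (f x y z)].
Proof.
move=> /natural_hull_nbhs[e1 n1] /natural_hull_nbhs[e2 n2].
move=> /natural_hull_nbhs[e3 n3] l1 l2 l3 nW cW.
have [r r0 rW] := trilinear_weights e1 e2 e3 l1 l2 l3 nW cW.
exists (abs_convex_hull (range (fun n => r n *: e1 n))).
exists (abs_convex_hull (range (fun n => r n *: e2 n))).
exists (abs_convex_hull (range (fun n => r n *: e3 n))).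
by split; [exact: n1|exact: n2|exact: n3|exact: rW].
Qed.

Lemma natural_bilinear (E1 E2 G : tvsType K) (f : E1 -> E2 -> G) (W : set G) :
  natural_topology E1 -> natural_topology E2 -> bilinear_map f ->
  nbhs 0 W -> absconvex W ->
  exists (A : set E1) (B : set E2),
    [/\ nbhs 0 A, nbhs 0 B & forall x y, A x -> B y -> W (f x y)].
Proof.
move=> /natural_hull_nbhs[e1 n1] /natural_hull_nbhs[e2 n2] [lr ll] nW cW.
(* The bilinear case is the trilinear one with a scalar third argument, spanned by the constant
   family 1. *)
have [|||r r0 rW] := @trilinear_weights E1 E2 K^o G e1 e2 (fun=> 1)
  (fun x y c => c *: f x y) W _ _ _ nW cW.
- by move=> y z; apply: linear_scale; exact: ll.
- by move=> x z; apply: linear_scale; exact: lr.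
- by move=> x y a b c; rewrite scalerDl -scalerA.
(* The third hull contains the scalar [r 0], which multiplies the value of [f]; rescaling the first
   neighbourhood by [(r 0)^-1] cancels it. *)
have := nbhs0Z (r 0)^-1 (n1 r r0) => nA.
exists (fun x => abs_convex_hull (range (fun n => r n *: e1 n)) ((r 0)^-1 *: x)).
exists (abs_convex_hull (range (fun n => r n *: e2 n))).
split; [exact: nA|exact: n2|move=> x y Ax By].
have := rW _ _ (r 0) Ax By; rewrite (lin_mapZ (ll y)) scalerA divff ?gt_eqF//.
rewrite scale1r; apply; apply: sub_hull; exists 0%N => //.
exact: mulr1.
Qed.

End NaturalTopology.

(** * Continuous linear maps out of completed projective tensor products *)

Section CompletedTensor.
Context (K : numFieldType) (T : projTensor K).

Lemma pt_nbhs0 (E F : tvsType K) (A : set E) (B : set F) :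
  nbhs 0 A -> nbhs 0 B ->
  nbhs 0 (closure (abs_convex_hull [set pure T x y | x in A & y in B])).
Proof. by move=> nA nB; apply: (pt_topology _).2; exists A, B; split. Qed.

Lemma pt_absconvex_basis (E F : tvsType K) (W : set (T E F)) : nbhs 0 W ->
  exists W', [/\ nbhs 0 W', absconvex W', closure W' `<=` W' & W' `<=` W].
Proof.
move=> /(pt_topology _).1[A [B [nA nB ABW]]].
exists (closure (abs_convex_hull [set pure T x y | x in A & y in B])); split=> //.
- exact: pt_nbhs0.
- exact/absconvex_closure/absconvex_hull.
- by move=> x; apply: closed_closure.
Qed.

(** The target is a completed tensor product because [pt_absconvex_basis] then supplies the
    absolutely convex neighbourhoods that [natural_bilinear] requires. *)
Lemma natural_cbilinear (E1 E2 E F : tvsType K) (f : E1 -> E2 -> T E F) :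
  natural_topology E1 -> natural_topology E2 -> bilinear_map f -> cbilinear f.
Proof.
move=> n1 n2 bf; apply: bilinear_continuous0 => // W /pt_absconvex_basis.
move=> [W' [nW' cW' _ W'W]].
have [A [B [nA nB AB]]] := natural_bilinear n1 n2 bf nW' cW'.
by exists A, B; split=> // x y Ax By; apply: W'W; exact: AB.
Qed.

(** The universal property provides an element of the set from which [tlift] chooses, so the junk
    value is excluded. *)
Lemma tliftP (E F E' F' : tvsType K) (f : E -> F -> T E' F') : cbilinear f ->
  clinear (tlift T f) /\ forall x y, tlift T f (pure T x y) = f x y.
Proof.
move=> cf; have [h [hP _]] := pt_univ T (@pt_hausdorff K T E' F')
  (@pt_complete K T E' F') cf.
exact: (@xgetPex _ (fun=> 0) [set h | clinear h /\ forall x y, h (pure T x y) = f x y]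
  (ex_intro _ h hP)).
Qed.

(** This is the uniqueness half of the universal property: both maps factor the same continuous
    bilinear map. *)
Lemma tens_ext (E F E' F' : tvsType K) (h1 h2 : T E F -> T E' F') :
  clinear h1 -> clinear h2 ->
  (forall x y, h1 (pure T x y) = h2 (pure T x y)) -> h1 =1 h2.
Proof.
move=> c1 c2 e12.
have cb : cbilinear (fun x y => h1 (@pure _ T E F x y)).
  apply: (cbilinear_comp (pt_cbilinear T E F) (clinear_id E) (clinear_id F) c1).
have [h [_ hU]] := pt_univ T (@pt_hausdorff K T E' F') (@pt_complete K T E' F') cb.
move=> t; rewrite -(hU h1 (conj c1 (fun x y => erefl))).
by rewrite -(hU h2 (conj c2 (fun x y => esym (e12 x y)))).
Qed.

Lemma tmapP (E F E' F' : tvsType K) (f : E -> E') (g : F -> F') :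
  clinear f -> clinear g -> clinear (tmap T f g) /\
    forall x y, tmap T f g (pure T x y) = pure T (f x) (g y).
Proof.
move=> cf cg; apply: tliftP.
exact: (cbilinear_comp (pt_cbilinear T E' F') cf cg (clinear_id _)).
Qed.

Lemma tmap_clinear (E F E' F' : tvsType K) (f : E -> E') (g : F -> F') :
  clinear f -> clinear g -> clinear (tmap T f g).
Proof. by move=> cf cg; have [] := tmapP cf cg. Qed.

Lemma tmap_pure (E F E' F' : tvsType K) (f : E -> E') (g : F -> F') x y :
  clinear f -> clinear g -> tmap T f g (pure T x y) = pure T (f x) (g y).
Proof. by move=> cf cg; have [_] := tmapP cf cg. Qed.

Lemma tmap_comp (E F E' F' E'' F'' : tvsType K) (f : E -> E') (g : F -> F')
    (f' : E' -> E'') (g' : F' -> F'') t :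
  clinear f -> clinear g -> clinear f' -> clinear g' ->
  tmap T f' g' (tmap T f g t) = tmap T (fun x => f' (f x)) (fun y => g' (g y)) t.
Proof.
move=> cf cg cf' cg'.
have cff := clinear_comp cf' cf; have cgg := clinear_comp cg' cg.
apply: (tens_ext (h1 := fun t => tmap T f' g' (tmap T f g t))).
- exact: (clinear_comp (tmap_clinear cf' cg') (tmap_clinear cf cg)).
- exact: tmap_clinear.
- by move=> x y; rewrite !tmap_pure.
Qed.

(* The neighbourhoods of 0 in [T E F] are generated by pure tensors, so a bound
   on pure tensors suffices. *)
Lemma tlift_family_cbilinear (P E F E' F' : tvsType K)
    (f : P -> E -> F -> T E' F') :
  (forall p, cbilinear (f p)) -> (forall x y, linear (fun p => f p x y)) ->
  (forall W, nbhs 0 W -> absconvex W -> exists (A : set P) (B : set E) (C : set F),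
    [/\ nbhs 0 A, nbhs 0 B, nbhs 0 C &
        forall p x y, A p -> B x -> C y -> W (f p x y)]) ->
  cbilinear (fun p t => tlift T (f p) t).
Proof.
move=> cf lf cf0; apply: bilinear_continuous0.
  split=> [p|t a p q].
    by have [[]] := tliftP (cf p).
  have [c1 e1] := tliftP (cf (a *: p + q)).
  have [c2 e2] := tliftP (cf p); have [c3 e3] := tliftP (cf q).
  apply: (tens_ext (h1 := tlift T (f (a *: p + q)))
    (h2 := fun t => a *: tlift T (f p) t + tlift T (f q) t)) => //.
    by apply: clinear_add => //; exact: clinear_scale.
  by move=> x y; rewrite e1 e2 e3 lf.
move=> W /pt_absconvex_basis[W' [nW' cW' clW' W'W]].
have [A [B [C [nA nB nC ABC]]]] := cf0 W' nW' cW'.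
exists A; exists (closure (abs_convex_hull [set pure T x y | x in B & y in C])).
split=> //; first exact: pt_nbhs0.
(* By continuity of the lift, the image of a point in the closure of the hull lies in the closure of
   [W'], hence in [W']; on the hull itself the bound comes from pure tensors. *)
move=> p t Ap Ht; apply: W'W; apply: clW'; have [[lh ch] hP] := tliftP (cf p).
move=> N nN; have [s [Hs Ns]] := Ht _ (ch t N nN).
exists (tlift T (f p) s); split => //.
apply: (hull_min (absconvex_preimage lh cW') _ Hs) => _ [x Bx [y Cy <-]] /=.
by rewrite hP; exact: ABC.
Qed.

End CompletedTensor.
(** * The enveloping algebra *)

(** Subalgebras are given as predicates, and [subalg_type] turns them into algebras so that the
    universal property of U(g) can be applied with a subalgebra as target. *)
Record subalgebra (K : numFieldType) (A : algType K) := Subalgebra {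
  subalg_set :> A -> Prop;
  subalg1 : subalg_set 1;
  subalgP : forall a x y, subalg_set x -> subalg_set y -> subalg_set (a *: x + y);
  subalgM : forall x y, subalg_set x -> subalg_set y -> subalg_set (x * y)
}.

Section SubalgebraType.
Context (K : numFieldType) (A : algType K) (S : subalgebra A).

Definition subalg_mem : {pred A} := fun x => `[< S x >].

Lemma subalg_mem_closed : GRing.subalg_closed subalg_mem.
Proof.
split=> [|a x y|x y]; rewrite !unfold_in /subalg_mem => *.
- by apply/asboolP; exact: subalg1.
- by apply/asboolP/subalgP; exact/asboolP.
- by apply/asboolP/subalgM; exact/asboolP.
Qed.

HB.instance Definition _ :=
  GRing.isSubalgClosed.Build K A subalg_mem subalg_mem_closed.

Definition subalg_type := {x : A | x \in subalg_mem}.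

HB.instance Definition _ := SubType.on subalg_type.
HB.instance Definition _ := Choice.on subalg_type.
HB.instance Definition _ := [SubChoice_isSubAlgebra of subalg_type by <:].

End SubalgebraType.

Section Enveloping.
Context (K : numFieldType) (g : topLieAlgebra K) (H : algType K) (iota : g -> H).
Hypothesis iota_lie : lie_to_alg iota.
Hypothesis iota_univ : forall (A : algType K) (f : g -> A), lie_to_alg f ->
  exists! phi : H -> A, alg_morphism phi /\ forall X, phi (iota X) = f X.

(** The universal property lifts [iota] to a morphism [phi] from [H] to [S]. Its composite with the
    inclusion and the identity both extend [iota], so they agree by uniqueness and every [u] is in
    [S]. *)
Lemma enveloping_ind (S : subalgebra H) :
  (forall X, S (iota X)) -> forall u, S u.
Proof.
move=> Siota.
have mS X : iota X \in subalg_mem S by apply/asboolP.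
pose f X : subalg_type S := Sub (iota X) (mS X).
have lf : lie_to_alg f.
  split=> [a X Y|X Y]; apply: val_inj; rewrite /= ?raddfB/= ?rmorphM/=.
    by rewrite iota_lie.1.
  by rewrite iota_lie.2.
have [phi [[[lphi phi1 phiM] phif] _]] := iota_univ lf.
have [h [_ hU]] := iota_univ iota_lie.
have h_id : h = id by apply: hU; split=> //; split.
have h_phi : h = (fun u => val (phi u)).
  apply: hU; split=> [|X]; last by rewrite phif.
  by split=> [a x y|//|x y]; rewrite ?lphi ?phi1 ?phiM.
move=> u; have -> : u = val (phi u).
  by rewrite -[LHS](congr1 (fun k => k u) h_id) h_phi.
by apply/asboolP; exact: (valP (phi u)).
Qed.

Definition monomial (s : seq g) : H := \prod_(X <- s) iota X.

Lemma monomial_cat s t : monomial (s ++ t) = monomial s * monomial t.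
Proof. exact: big_cat. Qed.

(** The linear combinations of monomials form a subalgebra containing [iota g], hence exhaust
    [H]. *)
Lemma enveloping_linear_ind (P : H -> Prop) :
  (forall a u v, P u -> P v -> P (a *: u + v)) ->
  (forall s, P (monomial s)) -> forall u, P u.
Proof.
move=> linP monP u.
have P0 : P 0.
  by have := linP (-1) _ _ (monP [::]) (monP [::]); rewrite scaleN1r addNr.
pose comb (l : seq (K * seq g)) := \sum_(p <- l) p.1 *: monomial p.2.
have combZ a l : comb [seq (a * p.1, p.2) | p <- l] = a *: comb l.
  by rewrite /comb big_map scaler_sumr; apply: eq_bigr => p _; rewrite scalerA.
have comb1 s : comb [:: (1, s)] = monomial s.
  by rewrite /comb big_seq1 scale1r.
pose span u := exists l, u = comb l.
have span1 : span 1 by exists [:: (1, [::])]; rewrite comb1 /monomial big_nil.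
have spanP a x y : span x -> span y -> span (a *: x + y).
  move=> [l ->] [m ->]; exists ([seq (a * p.1, p.2) | p <- l] ++ m).
  by rewrite -combZ /comb big_cat.
have spanM x y : span x -> span y -> span (x * y).
  move=> [l ->] [m ->]; exists [seq (p.1 * q.1, p.2 ++ q.2) | p <- l, q <- m].
  rewrite /comb big_allpairs_dep/= mulr_suml; apply: eq_bigr => p _.
  rewrite mulr_sumr; apply: eq_bigr => q _.
  by rewrite monomial_cat -scalerAl -scalerAr scalerA.
have [|l ->] := @enveloping_ind (Subalgebra span1 spanP spanM) _ u.
  by move=> X; exists [:: (1, [:: X])]; rewrite comb1 /monomial big_seq1.
rewrite /comb; elim: l => [|p l IH]; first by rewrite big_nil.
by rewrite big_cons; apply: linP.
Qed.

(** * Reordering monomials modulo shorter ones *)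

Section Symmetrization.
Variable P : H -> Prop.
Hypothesis linP : forall a u v, P u -> P v -> P (a *: u + v).
Hypothesis P0 : P 0.

Let PD u v : P u -> P v -> P (u + v).
Proof. by move=> Pu Pv; have := linP 1 Pu Pv; rewrite scale1r. Qed.

Let PZ a u : P u -> P (a *: u).
Proof. by move=> Pu; have := linP a Pu P0; rewrite addr0. Qed.

Let PB u v : P u -> P v -> P (u - v).
Proof. by move=> Pu Pv; rewrite -scaleN1r; apply: PD => //; exact: PZ. Qed.

Variable N : nat.
Hypothesis monP : forall s, (size s < N)%N -> P (monomial s).

(** Each time [X] crosses a letter [Y], the difference is a monomial in which [bracket X Y] replaces
    both letters; it has length less than [N] and so satisfies [P]. *)
Let monomial_move X a p b : (size (p ++ X :: a ++ b) <= N)%N ->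
  P (monomial (p ++ X :: a ++ b) - monomial (p ++ a ++ X :: b)).
Proof.
elim: a p => [|Y a IH] p sN; first by rewrite subrr.
have -> : monomial (p ++ X :: (Y :: a) ++ b) - monomial (p ++ (Y :: a) ++ X :: b)
  = monomial (p ++ bracket X Y :: a ++ b) +
    (monomial ((p ++ [:: Y]) ++ X :: a ++ b) -
     monomial ((p ++ [:: Y]) ++ a ++ X :: b)).
  rewrite -!catA /= addrA; congr (_ - _).
  rewrite !monomial_cat -mulrDr; congr (_ * _).
  by rewrite /monomial !big_cons iota_lie.2 mulrBl -!mulrA subrK.
apply: PD.
  by apply: monP; move: sN; rewrite !size_cat/= addnS.
by apply: IH; move: sN; rewrite !size_cat/= !addnS addn0 addSn.
Qed.

(** The head of [s] is moved to its place in [t] by [monomial_move]; the tails are compared by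
    induction, with that head appended to the fixed prefix [p]. *)
Let monomial_perm p s t : perm_eq s t -> (size (p ++ s) <= N)%N ->
  P (monomial (p ++ s) - monomial (p ++ t)).
Proof.
elim: s p t => [|X s IH] p t st sN.
  by move/perm_size/esym/size0nil: st => ->; rewrite subrr.
have /splitPr tP : X \in t by rewrite -(perm_mem st) mem_head.
case: tP st => a b st'.
have {st'}st : perm_eq s (a ++ b).
  by rewrite -(perm_cons X) (permPl st') -(cat1s X b) perm_catCA.
rewrite -(subrK (monomial (p ++ X :: a ++ b)) (monomial (p ++ X :: s))).
rewrite -addrA; apply: PD.
  have := IH (p ++ [:: X]) (a ++ b) st; rewrite -!catA/=.
  by apply.
apply: monomial_move; move: sN; rewrite !size_cat/=.
by rewrite (perm_size st) size_cat.
Qed.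

Let sym n (x : 'I_n -> g) : H := \sum_(s : {perm 'I_n}) \prod_(i < n) iota (x (s i)).

(** Modulo [P], all reorderings of [s] give the same monomial, so the symmetrized product is the
    factorial of [size s] times [monomial s]. That factorial is invertible in characteristic
    zero. *)
Lemma monomial_sym_step : (forall n (x : 'I_n -> g), P (sym x)) ->
  forall s, size s = N -> P (monomial s).
Proof.
move=> symP s sN; pose x (i : 'I_(size s)) := tnth (in_tuple s) i.
have sE : s = [seq x i | i <- enum 'I_(size s)].
  by rewrite (map_tnth_enum (in_tuple s)).
have prodE (t : {perm 'I_(size s)}) : \prod_(i < size s) iota (x (t i)) =
    monomial [seq x (t i) | i <- enum 'I_(size s)].
  by rewrite /monomial big_map enumT [index_enum _]unlock.
have permE (t : {perm 'I_(size s)}) :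
    perm_eq [seq x (t i) | i <- enum 'I_(size s)] s.
  rewrite [X in perm_eq _ X]sE (map_comp x t); apply: perm_map.
  apply: uniq_perm; [|exact: enum_uniq|].
    by rewrite (map_inj_uniq (@perm_inj _ t)) enum_uniq.
  move=> i; rewrite mem_enum; apply/mapP; exists (t^-1%g i).
    by rewrite mem_enum.
  by rewrite permKV.
have : P ((size s)`!%:R *: monomial s).
  have -> : (size s)`!%:R *: monomial s = sym x -
      \sum_(t : {perm 'I_(size s)}) (monomial [seq x (t i) | i <- enum 'I_(size s)]
        - monomial s).
    rewrite /sym -sumrB; under eq_bigr do rewrite prodE opprB addrC subrK.
    by rewrite sumr_const scaler_nat card_Sn.
  apply: PB => //; elim/big_rec: _ => // t u _ Pu; apply: PD => //.
  apply: (@monomial_perm [::]) => //=.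
  by rewrite (perm_size (permE t)) sN.
by move=> /(PZ (size s)`!%:R^-1); rewrite scalerA mulVf ?scale1r//.
Qed.

End Symmetrization.

(* The surjective half of the Poincare-Birkhoff-Witt theorem. *)
Lemma enveloping_sym_ind (P : H -> Prop) :
  (forall a u v, P u -> P v -> P (a *: u + v)) ->
  (forall n (x : 'I_n -> g),
    P (\sum_(s : {perm 'I_n}) \prod_(i < n) iota (x (s i)))) ->
  forall u, P u.
Proof.
move=> linP symP; have P0 : P 0.
  have := symP 0%N (fun=> 0) => P1.
  by have := linP (-1) _ _ P1 P1; rewrite scaleN1r addNr.
apply: enveloping_linear_ind => // s; have [n] := ubnP (size s).
elim: n s => [//|n IH] s; rewrite ltnS leq_eqVlt => /predU1P[sn|]; last exact: IH.
exact: (monomial_sym_step linP P0 IH symP sn).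
Qed.

(** The commutator with [y] is a derivation, and this is its Leibniz rule. *)
Lemma prod_commutator n (F : 'I_n -> H) (y : H) :
  (\prod_(i < n) F i) * y - y * (\prod_(i < n) F i) =
  \sum_(k < n) \prod_(i < n) (if i == k then F i * y - y * F i else F i).
Proof.
elim: n F => [|n IH] F; first by rewrite !big_ord0 mulr1 mul1r subrr.
rewrite [in LHS]big_ord_recl [in RHS]big_ord_recl; set Q := \prod_(i < n) _.
have -> : \prod_(i < n.+1) (if i == ord0 then F i * y - y * F i else F i) =
    (F ord0 * y - y * F ord0) * Q.
  by rewrite big_ord_recl eqxx.
transitivity ((F ord0 * y - y * F ord0) * Q + F ord0 * (Q * y - y * Q)).
  by rewrite mulrBl mulrBr !mulrA [RHS]addrC addrA subrK.
congr (_ + _); rewrite IH mulr_sumr; apply: eq_bigr => k _.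
by rewrite big_ord_recl.
Qed.

(** By [enveloping_sym_ind], symmetrized products suffice. For [n != 1] the commutator with [iota X]
    is a sum of symmetrized products of [n] elements, one for each letter bracketed with [X], so
    both sides vanish. For [n = 1] the product is a single [iota] value. *)
Lemma canonical_projection_bracket (pi : H -> g) (u : H) (X : g) :
  canonical_projection iota pi ->
  pi (u * iota X - iota X * u) = bracket (pi u) X.
Proof.
move=> [lpi pi_iota pi_sym].
have [[_ lbr] _] := bracket_cbilinear g.
elim/enveloping_sym_ind: u => [a u v Pu Pv|n x].
  rewrite mulrDl mulrDr -scalerAl -scalerAr opprD addrACA -scalerBr.
  by rewrite !lpi lbr Pu Pv.
have [n1|n1] := eqVneq n 1%N; last first.
  rewrite pi_sym// (lin_map0 (lbr X)).
  pose x' (j i : 'I_n) := if i == j then bracket (x i) X else x i.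
  rewrite (_ : _ - _ = \sum_(j < n) \sum_(s : {perm 'I_n})
      \prod_(i < n) iota (x' j (s i))).
    by rewrite (lin_map_sum lpi) big1// => j _; exact: pi_sym.
  rewrite exchange_big/= mulr_suml mulr_sumr -sumrB; apply: eq_bigr => s _.
  (* The Leibniz rule runs over positions [k], the other sum over letters [j]; the substitution
     [j = s k] matches them. *)
  rewrite prod_commutator [RHS](reindex_inj (@perm_inj _ s))/=; apply: eq_bigr => k _.
  apply: eq_bigr => i _; rewrite /x' (inj_eq perm_inj).
  by case: eqP => // _; rewrite iota_lie.2.
subst n; have -> : \sum_(s : {perm 'I_1}) \prod_(i < 1) iota (x (s i)) = iota (x ord0).
  under eq_bigr do rewrite big_ord1 [_ ord0]ord1.
  by rewrite sumr_const card_Sn.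
by rewrite -iota_lie.2 !pi_iota.
Qed.

End Enveloping.
(** * The AYD condition over a Hopf algebra *)

Section HopfTwist.
Context (K : numFieldType) (T : projTensor K) (H : topHopfAlgebra T).
Hypothesis H_nat : natural_topology H.

Lemma mul_cbilinear : cbilinear (fun a b : H => a * b).
Proof.
have := cbilinear_comp (pt_cbilinear T H H) (clinear_id H) (clinear_id H)
  (@mul_clinear _ _ H).
suff -> : (fun a b : H => a * b) = (fun a b : H => Defs.mul (pure T a b)) by [].
by apply/funext => a; apply/funext => b; rewrite mul_pure.
Qed.

Lemma mull_clinear (a : H) : clinear (fun u : H => a * u).
Proof. exact: (cbilinear_clinearr a mul_cbilinear). Qed.

Lemma mulr_clinear (a : H) : clinear (fun u : H => u * a).
Proof. exact: (cbilinear_clinearl a mul_cbilinear). Qed.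

Lemma pure_linearl (E F : tvsType K) (y : F) :
  linear (fun x : E => pure T x y).
Proof. by have [[_ +] _] := pt_cbilinear T E F; apply. Qed.

Lemma pure_linearr (E F : tvsType K) (x : E) :
  linear (fun y : F => pure T x y).
Proof. by have [[+ _] _] := pt_cbilinear T E F; apply. Qed.

Lemma antipode1 : antipode (1 : H) = 1.
Proof.
have [cS cid] := (@antipode_clinear _ _ H, clinear_id H).
have := antipodel (1 : H).
by rewrite comul_one tmap_pure// mul_pure mulr1 counit_one scale1r.
Qed.

(** Joint continuity in [a] and [t] is what allows [mul_legs] to be lifted to the completed tensor
    product at each step. *)
Lemma lmul_cbilinear (V : tvsType K) :
  cbilinear (fun (a : H) (t : T H V) => tmap T (fun u : H => a * u) id t).
Proof.
apply: tlift_family_cbilinear.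
- move=> a; exact: (cbilinear_comp (pt_cbilinear T H V) (mull_clinear a)
    (clinear_id V) (clinear_id _)).
- by move=> x y a p q; rewrite mulrDl -scalerAl (pure_linearl y).
- move=> W nW _; have [A [B [nA nB AB]]] := cbilinear_nbhs0 (pt_cbilinear T H V) nW.
  have [A1 [A2 [nA1 nA2 A12]]] := cbilinear_nbhs0 mul_cbilinear nA.
  by exists A1, A2, B; split=> // p x y ? ? ?; apply: AB => //; exact: A12.
Qed.

Section Action.
Context (V : tvsType K) (act : V -> H -> V).
Hypothesis act_mod : alg_rmodule act.
Hypothesis act_cont : forall a, continuous (fun v => act v a).

Lemma act_clinear a : clinear (fun v => act v a).
Proof. by split; [have [[_ +] _ _] := act_mod; apply|exact: act_cont]. Qed.

(* With [a], [b], [c] the legs of the iterated coproduct of h, the right-hand side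
   of the AYD condition is the sum of the [twist a b c (nabla v)]. *)
Definition twist (a b c : H) : T H V -> T H V :=
  tmap T (fun u => antipode c * u * a) (fun w => act w b).

Lemma twist_legl_clinear a c : clinear (fun u : H => antipode c * u * a).
Proof. exact: (clinear_comp (mulr_clinear a) (mull_clinear _)). Qed.

Lemma twist_clinear a b c : clinear (twist a b c).
Proof. exact: tmap_clinear (twist_legl_clinear a c) (act_clinear b). Qed.

Lemma twist_pure a b c u w :
  twist a b c (pure T u w) = pure T (antipode c * u * a) (act w b).
Proof. exact: tmap_pure (twist_legl_clinear a c) (act_clinear b). Qed.

Lemma twist_linear1 b c t : linear (fun a => twist a b c t).
Proof.
move=> k a a'.
apply: (tens_ext (h1 := twist (k *: a + a') b c)
  (h2 := fun t => k *: twist a b c t + twist a' b c t)).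
- exact: twist_clinear.
- by apply: clinear_add; [apply: clinear_scale|]; exact: twist_clinear.
- by move=> u w; rewrite !twist_pure mulrDr -scalerAr (pure_linearl _).
Qed.

Lemma twist_linear2 a c t : linear (fun b => twist a b c t).
Proof.
move=> k b b'.
apply: (tens_ext (h1 := twist a (k *: b + b') c)
  (h2 := fun t => k *: twist a b c t + twist a b' c t)).
- exact: twist_clinear.
- by apply: clinear_add; [apply: clinear_scale|]; exact: twist_clinear.
- move=> u w; rewrite !twist_pure; have [[lact _] _ _] := act_mod.
  by rewrite lact (pure_linearr _).
Qed.

Lemma twist_linear3 a b t : linear (fun c => twist a b c t).
Proof.
move=> k c c'.
apply: (tens_ext (h1 := twist a b (k *: c + c'))
  (h2 := fun t => k *: twist a b c t + twist a b c' t)).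
- exact: twist_clinear.
- by apply: clinear_add; [apply: clinear_scale|]; exact: twist_clinear.
- move=> u w; rewrite !twist_pure; have [lS _] := @antipode_clinear _ _ H.
  by rewrite lS 2!mulrDl -2!scalerAl (pure_linearl _).
Qed.

Lemma twist1 t : twist 1 1 1 t = t.
Proof.
have [_ act1 _] := act_mod.
apply: (tens_ext (twist_clinear 1 1 1) (clinear_id _)) => u w.
by rewrite twist_pure antipode1 mul1r mulr1 act1.
Qed.

(** On pure tensors, S(cc') u aa' = S(c') (S(c) u a) a' and w (bb') = (w b) b'. *)
Lemma twistM : (forall a b : H, antipode (a * b) = antipode b * antipode a) ->
  forall a b c a' b' c' t,
  twist (a * a') (b * b') (c * c') t = twist a' b' c' (twist a b c t).
Proof.
move=> SM a b c a' b' c' t; have [_ _ actM] := act_mod.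
apply: (tens_ext (h1 := twist (a * a') (b * b') (c * c'))
  (h2 := fun t => twist a' b' c' (twist a b c t))).
- exact: twist_clinear.
- exact: clinear_comp (twist_clinear _ _ _) (twist_clinear _ _ _).
- by move=> u w; rewrite !twist_pure SM actM !mulrA.
Qed.

Definition twist_lift2 t a : T H H -> T H V := tlift T (fun b c => twist a b c t).

Lemma twist_cbilinear t a : cbilinear (fun b c => twist a b c t).
Proof.
apply: natural_cbilinear => //.
by split=> [b|c]; [exact: twist_linear3|exact: twist_linear2].
Qed.

Lemma twist_lift2_cbilinear t : cbilinear (twist_lift2 t).
Proof.
apply: tlift_family_cbilinear.
- exact: twist_cbilinear.
- by move=> b c; exact: twist_linear1.
- move=> W nW cW; apply: natural_trilinear => //.
  + by move=> b c; exact: twist_linear1.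
  + by move=> a c; exact: twist_linear2.
  + by move=> a b; exact: twist_linear3.
Qed.

(** With [t := nabla v] this is, up to unfolding, the nested lift inside [hopf_AYD_rhs]. *)
Definition twist_lift t : T H (T H H) -> T H V := tlift T (twist_lift2 t).

Lemma twist_lift_clinear t : clinear (twist_lift t).
Proof. by have [] := tliftP (twist_lift2_cbilinear t). Qed.

Lemma twist_lift_pure t a b c :
  twist_lift t (pure T a (pure T b c)) = twist a b c t.
Proof.
have [_ e2] := tliftP (twist_lift2_cbilinear t).
have [_ e1] := tliftP (twist_cbilinear t a).
by rewrite /twist_lift e2 /twist_lift2 e1.
Qed.

Lemma tmap_id_comul_clinear : clinear (tmap T id (@comul _ _ H) : T H H -> T H (T H H)).
Proof. exact: tmap_clinear (clinear_id _) (@comul_clinear _ _ H). Qed.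

Lemma hopf_AYD_rhs_linear (nabla : V -> T H V) v :
  linear (hopf_AYD_rhs act nabla v).
Proof.
apply: (linear_comp (twist_lift_clinear (nabla v)).1).
exact: (linear_comp tmap_id_comul_clinear.1 (@comul_clinear _ _ H).1).
Qed.

(** Once the coproducts are finite sums of pure tensors, the lifts disappear and the right-hand side
    becomes a finite sum of operators applied to [nabla v]. *)
Lemma hopf_AYD_rhs_decomp (nabla : V -> T H V) v h
    (I : Type) (l : seq I) (x : I -> H * H) (m : I -> seq (H * H)) :
  comul h = \sum_(i <- l) pure T (x i).1 (x i).2 ->
  (forall i, comul (x i).2 = \sum_(y <- m i) pure T y.1 y.2) ->
  hopf_AYD_rhs act nabla v h =
  \sum_(i <- l) \sum_(y <- m i) twist (x i).1 y.1 y.2 (nabla v).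
Proof.
move=> hl hm; have cL := twist_lift_clinear (nabla v).
transitivity (twist_lift (nabla v) (tmap T id (@comul _ _ H) (comul h))) => //.
rewrite hl (lin_map_sum tmap_id_comul_clinear.1) (lin_map_sum cL.1).
apply: eq_bigr => i _.
rewrite (tmap_pure T _ _ (clinear_id _) (@comul_clinear _ _ H)) hm.
rewrite (lin_map_sum (pure_linearr _)) (lin_map_sum cL.1).
by apply: eq_bigr => y _; rewrite twist_lift_pure.
Qed.

(** On a pure tensor of [u] and [w], the three terms of the iterated coproduct, with [h] in the
    first, second and third leg, contribute [u * h] on the left, [act w h] on the right, and
    [- h * u] on the left. *)
Lemma hopf_AYD_rhs_primitive (nabla : V -> T H V) v h :
  comul h = pure T h 1 + pure T 1 h -> antipode h = - h ->
  hopf_AYD_rhs act nabla v h =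
  tmap T id (fun w => act w h) (nabla v) +
  tmap T (fun u => u * h - h * u) id (nabla v).
Proof.
move=> comulh Sh; have cL := twist_lift_clinear (nabla v).
have cD : clinear (fun u : H => u * h - h * u).
  by apply: clinear_sub; [exact: mulr_clinear|exact: mull_clinear].
transitivity (twist_lift (nabla v) (tmap T id (@comul _ _ H) (comul h))) => //.
have tm := tmap_pure T _ _ (clinear_id _) (@comul_clinear _ _ H).
rewrite comulh (lin_mapD tmap_id_comul_clinear.1) !tm comul_one comulh.
rewrite (lin_mapD (pure_linearr _)) !(lin_mapD cL.1) !twist_lift_pure.
move: (nabla v) => t.
apply: (tens_ext
  (h1 := fun t => twist h 1 1 t + (twist 1 h 1 t + twist 1 1 h t))
  (h2 := fun t => tmap T id (fun w => act w h) t +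
    tmap T (fun u => u * h - h * u) id t)).
- by do 2?apply: clinear_add; exact: twist_clinear.
- by apply: clinear_add; apply: tmap_clinear => //;
    [exact: clinear_id|exact: act_clinear|exact: clinear_id].
move=> u w; have [_ act1 _] := act_mod.
have e1 := tmap_pure T u w (clinear_id _) (act_clinear h).
have e2 := tmap_pure T u w cD (clinear_id _).
rewrite !twist_pure e1 e2.
rewrite antipode1 !mul1r !mulr1 !act1 Sh mulNr addrCA; congr (_ + _).
by rewrite (lin_mapB (pure_linearl _)) (lin_mapN (pure_linearl _)).
Qed.

End Action.

(** Both nested lifts in [tprod] must be shown to exist before they can be evaluated. The inner one
    comes from continuity of the product, the outer one from the natural topology of [H]. *)
Lemma tprod_sum (I J : Type) (r : seq I) (s : seq J) (x : I -> H * H) (y : J -> H * H) :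
  tprod T (\sum_(i <- r) pure T (x i).1 (x i).2)
          (\sum_(j <- s) pure T (y j).1 (y j).2) =
  \sum_(i <- r) \sum_(j <- s)
    pure T ((x i).1 * (y j).1) ((x i).2 * (y j).2).
Proof.
have cr a b : cbilinear (fun c d : H => pure T (a * c) (b * d)).
  exact: (cbilinear_comp (pt_cbilinear T H H) (mull_clinear a) (mull_clinear b)
    (clinear_id _)).
set t := \sum_(j <- s) _.
have cl : cbilinear (fun a b : H => tlift T (fun c d => pure T (a * c) (b * d)) t).
  apply: natural_cbilinear => //; split=> [a k b b'|b k a a'] /=.
    have [[c1 e1] [c2 e2] [c3 e3]] := And3 (tliftP (cr a (k *: b + b')))
      (tliftP (cr a b)) (tliftP (cr a b')).
    apply: (tens_ext (h1 := tlift T _) (h2 := fun t => k *: tlift T _ t + tlift T _ t)) => //.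
      by apply: clinear_add => //; exact: clinear_scale.
    by move=> c d; rewrite e1 e2 e3 mulrDl -scalerAl (pure_linearr _).
  have [[c1 e1] [c2 e2] [c3 e3]] := And3 (tliftP (cr (k *: a + a') b))
      (tliftP (cr a b)) (tliftP (cr a' b)).
  apply: (tens_ext (h1 := tlift T _) (h2 := fun t => k *: tlift T _ t + tlift T _ t)) => //.
    by apply: clinear_add => //; exact: clinear_scale.
  by move=> c d; rewrite e1 e2 e3 mulrDl -scalerAl (pure_linearl _).
have [[lt _] et] := tliftP cl.
rewrite /tprod (lin_map_sum lt); apply: eq_bigr => i _; rewrite et.
have [[lc _] ec] := tliftP (cr (x i).1 (x i).2).
by rewrite (lin_map_sum lc); apply: eq_bigr => j _; rewrite ec.
Qed.

End HopfTwist.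
(** * The exponential coaction *)

Section ExponentialCoaction.
Context (K : numFieldType) (T : projTensor K) (g : topLieAlgebra K)
  (V : tvsType K) (H : topHopfAlgebra T) (iota : g -> H).
Context (act : V -> g -> V) (nabla : V -> T g V).
Hypothesis iota_lie : lie_to_alg iota.
Hypothesis iota_cont : continuous iota.
Hypothesis act_clin : forall X, clinear (fun v => act v X).
Hypothesis nabla_clin : clinear nabla.

Let bracket_clin X : clinear (fun Y : g => bracket Y X).
Proof. exact: cbilinear_clinearl (bracket_cbilinear g). Qed.

(** This is the right-hand side of the U(g)-AYD condition at [iota X], as an operator on the
    completed tensor product. *)
Definition commutator_action X : T H V -> T H V := fun t =>
  tmap T id (fun w => act w X) t +
  tmap T (fun u => u * iota X - iota X * u) id t.

Let commutator_clin X : clinear (fun u : H => u * iota X - iota X * u).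
Proof. by apply: clinear_sub; [exact: mulr_clinear|exact: mull_clinear]. Qed.

Lemma commutator_action_clinear X : clinear (commutator_action X).
Proof.
by apply: clinear_add; apply: tmap_clinear; by [|exact: clinear_id].
Qed.

Lemma commutator_action_pure X u w : commutator_action X (pure T u w) =
  pure T u (act w X) + pure T (u * iota X - iota X * u) w.
Proof.
by rewrite /commutator_action (tmap_pure T _ _ (clinear_id _) (act_clin X))
  (tmap_pure T _ _ (commutator_clin X) (clinear_id _)).
Qed.

(* The diagonal action of [X] on [g (x) ... (x) g (x) V], adjoint on the copies
   of [g]. *)
Fixpoint leg_action X k : tpower T g V k -> tpower T g V k :=
  if k is k'.+1 return tpower T g V k -> tpower T g V k
  then fun t => tmap T id (@leg_action X k') t + tmap T (fun Y => bracket Y X) id t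
  else fun v => act v X.

Lemma leg_action_clinear X k : clinear (@leg_action X k).
Proof.
elim: k => [|k IH]; first exact: act_clin.
by apply: clinear_add; apply: tmap_clinear => //; exact: clinear_id.
Qed.

Lemma iter_coaction_clinear k : clinear (iter_coaction T nabla k).
Proof.
elim: k => [|k IH]; first exact: clinear_id.
by apply: clinear_comp nabla_clin; apply: tmap_clinear IH; exact: clinear_id.
Qed.

(** Induction on [k]: [nabla] splits the action of [X] into a bracket on the outer leg, which
    commutes with iterating on the inner one, and an action on the inner factor, to which the
    induction hypothesis applies. *)
Lemma iter_coaction_act X k v :
  (forall v, nabla (act v X) = tmap T id (fun w => act w X) (nabla v) +
    tmap T (fun Y => bracket Y X) id (nabla v)) ->
  iter_coaction T nabla k (act v X) = leg_action X (iter_coaction T nabla k v).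
Proof.
move=> AYD; elim: k v => [//|k IH] v /=.
have [cI cit cl] := And3 (clinear_id g) (iter_coaction_clinear k)
  (leg_action_clinear X k).
have e1 := tmap_comp (nabla v) cI (act_clin X) cI cit.
have e2 := tmap_comp (nabla v) (bracket_clin X) (clinear_id V) cI cit.
have e3 := tmap_comp (nabla v) cI cit cI cl.
have e4 := tmap_comp (nabla v) cI cit (bracket_clin X) (clinear_id (tpower T g V k)).
rewrite AYD (lin_mapD (tmap_clinear T cI cit).1) e1 e2 e3 e4.
by congr (tmap T id _ _ + _); apply/funext => w; exact: IH.
Qed.

Let M Y : T H V -> T H V := tmap T (fun u : H => iota Y * u) id.

Let M_clin Y : clinear (M Y).
Proof. exact: cbilinear_clinearr (lmul_cbilinear H V). Qed.

Let M_pure Y u w : M Y (pure T u w) = pure T (iota Y * u) w.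
Proof. exact: tmap_pure (mull_clinear (iota Y)) (clinear_id V). Qed.

Let mul_legs_cbilinear k : clinear (@mul_legs K T g V H iota k) ->
  cbilinear (fun Y t => M Y (@mul_legs K T g V H iota k t)).
Proof.
move=> cl; exact: (cbilinear_comp (lmul_cbilinear H V) (conj iota_lie.1 iota_cont)
  cl (clinear_id _)).
Qed.

Lemma mul_legs_clinear k : clinear (@mul_legs K T g V H iota k).
Proof.
elim: k => [|k IH]; first exact: (cbilinear_clinearr 1 (pt_cbilinear T H V)).
by have [] := tliftP (mul_legs_cbilinear IH).
Qed.

Lemma mul_legs_pure k Y t : @mul_legs K T g V H iota k.+1 (pure T Y t) =
  M Y (mul_legs T iota k t).
Proof. by have [_ /= ->] := tliftP (mul_legs_cbilinear (mul_legs_clinear k)). Qed.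

(** Multiplying the legs turns the diagonal action into a commutator because [iota] sends brackets
    to commutators and the commutator with [iota X] is a derivation. For [k = 0] the left factor is
    1, which commutes with [iota X]. *)
Lemma mul_legs_act X k (t : tpower T g V k) :
  mul_legs T iota k (leg_action X t) = commutator_action X (mul_legs T iota k t).
Proof.
have cC := commutator_action_clinear X.
elim: k t => [|k IH] t.
  by rewrite /= commutator_action_pure mul1r mulr1 subrr
    (lin_map0 (pure_linearl T _)) addr0.
apply: (tens_ext (h1 := fun t => @mul_legs K T g V H iota k.+1 (@leg_action X k.+1 t))
  (h2 := fun t => commutator_action X (@mul_legs K T g V H iota k.+1 t))).
- exact: clinear_comp (mul_legs_clinear k.+1) (leg_action_clinear X k.+1).
- exact: clinear_comp cC (mul_legs_clinear k.+1).
move=> Y s; rewrite mul_legs_pure.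
have -> : @leg_action X k.+1 (pure T Y s) =
    pure T Y (leg_action X s) + pure T (bracket Y X) s.
  by rewrite /= (tmap_pure T _ _ (clinear_id _) (leg_action_clinear X k))
    (tmap_pure T _ _ (bracket_clin X) (clinear_id _)).
rewrite (lin_mapD (mul_legs_clinear k.+1).1) !mul_legs_pure IH.
move: (mul_legs T iota k s) => m.
(* On pure tensors this reduces to Y(uX - Xu) + (YX - XY)u = YuX - XYu. *)
apply: (tens_ext (h1 := fun m => M Y (commutator_action X m) + M (bracket Y X) m)
  (h2 := fun m => commutator_action X (M Y m))).
- by apply: clinear_add => //; exact: clinear_comp.
- exact: clinear_comp.
move=> u w; rewrite !M_pure !commutator_action_pure (lin_mapD (M_clin Y).1) !M_pure.
rewrite -addrA -(lin_mapD (pure_linearl T _)) iota_lie.2; congr (_ + pure T _ w).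
by rewrite mulrBr mulrBl !mulrA subrKA.
Qed.

(** The intertwining holds for each partial sum; it passes to the limit by continuity of
    [commutator_action X] and uniqueness of limits in a Hausdorff space. *)
Lemma exp_coaction_act (nablaU : V -> T H V) X v :
  (forall v, nabla (act v X) = tmap T id (fun w => act w X) (nabla v) +
    tmap T (fun Y => bracket Y X) id (nabla v)) ->
  (forall v, series (exp_term iota nabla v) @ \oo --> nablaU v) ->
  nablaU (act v X) = commutator_action X (nablaU v).
Proof.
move=> AYD cvgU; have [lC cC] := commutator_action_clinear X.
have := cvgU (act v X).
have -> : series (exp_term iota nabla (act v X)) =
    (fun n => commutator_action X (series (exp_term iota nabla v) n)).
  apply/funext => n; rewrite /series/= (lin_map_sum lC); apply: eq_bigr => k _.
  by rewrite /exp_term iter_coaction_act// mul_legs_act (lin_mapZ lC).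
move=> cvg1; apply: (@cvg_unique _ (@pt_hausdorff K T H V) _ _ _ _ cvg1).
by apply: (@cvg_comp _ _ _ (series (exp_term iota nabla v)) (commutator_action X)
  _ _ _ (cvgU v)); exact: cC.
Qed.

End ExponentialCoaction.

(** * From generators of U(g) to all of U(g) *)

Section HopfAYD.
Context (K : numFieldType) (T : projTensor K) (g : topLieAlgebra K)
  (V : tvsType K) (H : topHopfAlgebra T) (iota : g -> H).
Context (act : V -> H -> V) (nabla : V -> T H V).
Hypothesis H_env : is_enveloping iota.
Hypothesis act_mod : alg_rmodule act.
Hypothesis act_iota_cont : forall X, continuous (fun v => act v (iota X)).

Let H_nat : natural_topology H. Proof. by have [] := H_env. Qed.

Lemma enveloping_act_continuous a : continuous (fun v => act v a).
Proof.
have [iota_lie iota_univ _ _] := H_env; have [[lr ll] act1 actM] := act_mod.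
suff : clinear (fun v => act v a) by case.
pose C a := clinear (fun v => act v a).
have C1 : C 1.
  by rewrite /C (_ : (fun v => act v 1) = id); [exact: clinear_id|exact/funext].
have CP k x y : C x -> C y -> C (k *: x + y).
  move=> Cx Cy; rewrite /C (_ : (fun v => _) = fun v => k *: act v x + act v y).
    by apply: clinear_add => //; exact: clinear_scale.
  by apply/funext => v; rewrite lr.
have CM x y : C x -> C y -> C (x * y).
  move=> Cx Cy; rewrite /C (_ : (fun v => _) = fun v => act (act v x) y).
    exact: clinear_comp Cy Cx.
  by apply/funext => v; rewrite actM.
apply: (enveloping_ind iota_lie iota_univ (S := Subalgebra C1 CP CM)) => X.
by split; [exact: ll|exact: act_iota_cont].
Qed.

(** The elements whose coproduct lies in the algebraic tensor product, without completion, form a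
    subalgebra containing the primitive elements [iota X]. *)
Lemma enveloping_comul_decomp (h : H) : exists l : seq (H * H),
  comul h = \sum_(x <- l) pure T x.1 x.2.
Proof.
have [iota_lie iota_univ _ [comulX _ _ _]] := H_env.
pose D (h : H) := exists l : seq (H * H), comul h = \sum_(x <- l) pure T x.1 x.2.
have D1 : D 1 by exists [:: (1, 1)]; rewrite big_seq1 comul_one.
have DP k x y : D x -> D y -> D (k *: x + y).
  move=> [l lE] [m mE]; exists ([seq (k *: p.1, p.2) | p <- l] ++ m).
  rewrite (@comul_clinear _ _ H).1 lE mE big_cat big_map/= scaler_sumr.
  congr (_ + _); apply: eq_bigr => p _.
  by rewrite (lin_mapZ (pure_linearl T _)).
have DM x y : D x -> D y -> D (x * y).
  move=> [l lE] [m mE]; exists [seq (p.1 * q.1, p.2 * q.2) | p <- l, q <- m].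
  by rewrite comul_mul lE mE (tprod_sum H_nat) big_allpairs_dep.
apply: (enveloping_ind iota_lie iota_univ (S := Subalgebra D1 DP DM)) => X.
by exists [:: (iota X, 1); (1, iota X)]; rewrite big_cons big_seq1 comulX.
Qed.

Lemma hopf_AYD_of_generators :
  (forall v X, nabla (act v (iota X)) = hopf_AYD_rhs act nabla v (iota X)) ->
  clinear nabla ->
  forall v h, nabla (act v h) = hopf_AYD_rhs act nabla v h.
Proof.
move=> AYDX [lnabla _] v h.
have [iota_lie iota_univ _ [_ _ _ SM]] := H_env.
have [[lr ll] act1 actM] := act_mod.
have act_cont := enveloping_act_continuous.
have /choice[d dE] := enveloping_comul_decomp.
pose S (h : H) := forall v, nabla (act v h) = hopf_AYD_rhs act nabla v h.
have S1 : S 1.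
  move=> w; rewrite act1 (hopf_AYD_rhs_decomp H_nat act_mod act_cont nabla w
    (l := [:: tt]) (x := fun=> (1, 1)) (m := fun=> [:: (1, 1)])) ?big_seq1.
  - by rewrite (twist1 act_mod act_cont).
  - exact: comul_one.
  - by move=> _; exact: comul_one.
have SP k x y : S x -> S y -> S (k *: x + y).
  move=> Sx Sy w; rewrite lr lnabla Sx Sy.
  by rewrite (hopf_AYD_rhs_linear H_nat act_mod act_cont).
have SMul x y : S x -> S y -> S (x * y).
  move=> Sx Sy w; rewrite actM Sy.
  (* The sum over [d b] is put outside because the twists by the legs of [y] are applied after those
     by the legs of [x]. *)
  have dM a b : comul (a * b) = \sum_(q <- d b) \sum_(p <- d a)
      pure T (p.1 * q.1) (p.2 * q.2).
    by rewrite comul_mul (dE a) (dE b) (tprod_sum H_nat) exchange_big.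
  rewrite (hopf_AYD_rhs_decomp H_nat act_mod act_cont nabla (act w x) (x := id)
    (dE y) (fun p => dE p.2)) Sx.
  rewrite (hopf_AYD_rhs_decomp H_nat act_mod act_cont nabla w (x := id)
    (dE x) (fun p => dE p.2)).
  rewrite (hopf_AYD_rhs_decomp H_nat act_mod act_cont nabla w
    (l := [seq (p, q) | q <- d y, p <- d x])
    (x := fun r => (r.1.1 * r.2.1, r.1.2 * r.2.2))
    (m := fun r => [seq (t.1 * z.1, t.2 * z.2) | z <- d r.2.2, t <- d r.1.2])).
  - rewrite big_allpairs_dep; apply: eq_bigr => q _ /=.
    under [RHS]eq_bigr do rewrite big_allpairs_dep.
    rewrite [RHS]exchange_big; apply: eq_bigr => z _ /=.
    have cT := (twist_clinear act_mod act_cont q.1 z.1 z.2).1.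
    rewrite (lin_map_sum cT); apply: eq_bigr => p _ /=.
    rewrite (lin_map_sum cT); apply: eq_bigr => t _ /=.
    (* Each twist by legs of [y] after legs of [x] is the single twist by their products, which are
       the legs of the iterated coproduct of [x * y]. *)
    by rewrite (twistM act_mod act_cont SM).
  - by rewrite dM big_allpairs_dep.
  - by move=> r; rewrite dM big_allpairs_dep.
apply: (enveloping_ind iota_lie iota_univ (S := Subalgebra S1 SP SMul)) => X w.
exact: AYDX.
Qed.

End HopfAYD.

Theorem proposition4p15 (K : numFieldType) (T : projTensor K)
    (g : topLieAlgebra K) (V : tvsType K)
    (U : topHopfAlgebra T) (iota : g -> U) (pi : U -> g)
    (actg : V -> g -> V) (nablag : V -> T g V)
    (actU : V -> U -> V) (nablaU : V -> T U V)
    (g_wb : well_behaved g) (V_wb : well_behaved V) (U_wb : well_behaved U)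
    (g_nat : natural_topology g)
    (U_env : is_enveloping iota) (pi_can : canonical_projection iota pi)
    (V_gmod : lie_rmodule actg) (V_gcomod : lie_lcomodule nablag)
    (V_Umod : alg_rmodule actU)
    (actU_ext : forall v X, actU v (iota X) = actg v X)
    (V_Ucomod : hopf_lcomodule nablaU)
    (nabla_corr : coaction_correspondence iota pi nablag nablaU) :
  lie_AYD actg nablag <-> hopf_AYD actU nablaU.
Proof.
have [iota_lie iota_univ U_nat [comulX _ SX _]] := U_env.
have [[_ lactg] actg_cont _ _] := V_gmod.
have [nablag_clin _] := V_gcomod; have [nablaU_clin _ _] := V_Ucomod.
have [cvgU piU] := nabla_corr.
have iota_cont : continuous iota by apply: natural_linear_continuous iota_lie.1.
have actg_clin X : clinear (fun v => actg v X) by split; [exact: lactg|exact: actg_cont].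
have actUX X : (fun v => actU v (iota X)) = (fun v => actg v X) by exact/funext.
have actU_iota X : continuous (fun v => actU v (iota X)).
  by rewrite actUX; exact: actg_cont.
have actU_cont := enveloping_act_continuous U_env V_Umod actU_iota.
have rhsX v X : hopf_AYD_rhs actU nablaU v (iota X) =
    commutator_action iota actg X (nablaU v).
  rewrite (hopf_AYD_rhs_primitive U_nat V_Umod actU_cont)//.
  by rewrite actUX.
split=> [[_ _ AYDg]|[_ _ AYDU]]; split=> //.
(* Continuity in the variable of U(g) is automatic for the natural topology. *)
- split=> // v; apply: natural_linear_continuous => //.
  by have [[lact _] _ _] := V_Umod; exact: lact.
- apply: (hopf_AYD_of_generators U_env V_Umod actU_iota) => // v X.
  rewrite rhsX actU_ext.
  exact: (exp_coaction_act iota_lie iota_cont actg_clin nablag_clin v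
    (fun w => AYDg w X) cvgU).
have pi_clin : clinear pi.
  by have [lpi _ _] := pi_can; split=> //; exact: natural_linear_continuous.
have cpi := tmap_clinear T pi_clin (clinear_id V).
move=> v X; rewrite -!piU -actU_ext AYDU rhsX (lin_mapD cpi.1).
have comm_clin : clinear (fun u : U => u * iota X - iota X * u).
  by apply: clinear_sub; [exact: mulr_clinear|exact: mull_clinear].
have brk_clin : clinear (fun Y : g => bracket Y X).
  exact: cbilinear_clinearl (bracket_cbilinear g).
have e1 := tmap_comp (nablaU v) (clinear_id U) (actg_clin X) pi_clin (clinear_id V).
have e2 := tmap_comp (nablaU v) comm_clin (clinear_id V) pi_clin (clinear_id V).
have e3 := tmap_comp (nablaU v) pi_clin (clinear_id V) (clinear_id g) (actg_clin X).
have e4 := tmap_comp (nablaU v) pi_clin (clinear_id V) brk_clin (clinear_id V).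
(* After composition with [pi], the terms carrying the action on [V] coincide; what remains is that
   [pi] sends the commutator with [iota X] to the bracket with [X]. *)
rewrite e1 e2 e3 e4; congr (_ + tmap T _ _ _); apply/funext => u.
exact: (canonical_projection_bracket iota_lie iota_univ).
Qed.
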